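(* Let $\mathcal{S}$ be a Betti divisible numerical semigroup minimally generated by $A$. Then $\mathcal{C}_A=\mathcal{U}_A\subseteq\operatorname{Cr}_A=\mathcal{M}_A=\operatorname{Gr}_A$.
   Context: $\mathbb{K}$ is an arbitrary field and $\mathbb{N}$ contains $0$. For positive integers $a_1,\ldots,a_n$, $\langle a_1,\ldots,a_n\rangle=\{u_1a_1+\cdots+u_na_n\mid u_i\in\mathbb{N}\}$. A numerical semigroup is a submonoid of $\mathbb{N}$ generated by a finite set of positive integers with greatest common divisor $1$; its minimal generating set is its unique generating set no proper subset of which generates it. For $A=\{a_1,\ldots,a_n\}$, the $A$-degree of $\mathbf{x}^{\mathbf{u}}=x_1^{u_1}\cdots x_n^{u_n}$ is $u_1a_1+\cdots+u_na_n$, and the toric ideal of $A$ is $I_A=\langle \mathbf{x}^{\mathbf{u}}-\mathbf{x}^{\mathbf{v}}\mid \deg_A(\mathbf{x}^{\mathbf{u}})=\deg_A(\mathbf{x}^{\mathbf{v}})\rangle\subseteq\mathbb{K}[x_1,\ldots,x_n]$. In all the sets below, a binomial is identified with its opposite. - Markov basis: a generating set of $I_A$ consisting of binomials $\mathbf{x}^{\mathbf{u}}-\mathbf{x}^{\mathbf{v}}\in I_A$ that is minimal with respect to inclusion. The universal Markov basis $\mathcal{M}_A$ is the union of all Markov bases. The $A$-degrees of the elements of a Markov basis do not depend on the Markov basis; they are called the Betti degrees of $I_A$. - Graver basis $\operatorname{Gr}_A$: the set of primitive binomials, where a nonzero binomial $\mathbf{x}^{\mathbf{u}}-\mathbf{x}^{\mathbf{v}}\in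 I_A$ is primitive if there is no other nonzero binomial $\mathbf{x}^{\mathbf{w}}-\mathbf{x}^{\mathbf{z}}\in I_A$ with $\mathbf{x}^{\mathbf{w}}\mid\mathbf{x}^{\mathbf{u}}$ and $\mathbf{x}^{\mathbf{z}}\mid\mathbf{x}^{\mathbf{v}}$. - Universal Gröbner basis $\mathcal{U}_A$: the union of all reduced Gröbner bases of $I_A$ over all monomial orders. - Circuits $\mathcal{C}_A$: a binomial $\mathbf{x}^{\mathbf{u}}-\mathbf{x}^{\mathbf{v}}\in I_A$ is irreducible if $\operatorname{supp}(\mathbf{u})\cap\operatorname{supp}(\mathbf{v})=\emptyset$ (with $\operatorname{supp}(\mathbf{u})=\{i\mid u_i\neq0\}$) and the nonzero entries of $\mathbf{u}+\mathbf{v}$ are relatively prime; $\mathcal{C}_A$ is the set of irreducible binomials whose support $\operatorname{supp}(\mathbf{u})\cup\operatorname{supp}(\mathbf{v})$ is inclusion-minimal among nonzero binomials of $I_A$. Equivalently, $\mathcal{C}_A=\{x_i^{a_j/\gcd(a_i,a_j)}-x_j^{a_i/\gcd(a_i,a_j)}\mid i\neq j\}$. - Critical binomials $\operatorname{Cr}_A$: let $c_i=\min\{c\in\mathbb{Z}^+\mid c\,a_i\in\langle a_j\mid j\neq i\rangle\}$; whenever $c_ia_i=\sum_{j\neq i}r_{ij}a_j$ with $r_{ij}\in\mathbb{N}$, the binomial $x_i^{c_i}-\prod_{j\neq i}x_j^{r_{ij}}$ is a critical binomial with respect to $x_i$. $\operatorname{Cr}_A$ is the set of all critical binomials, for all $i$.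 A numerical semigroup with minimal generating set $A$ is Betti divisible if the Betti degrees of $I_A$ are (totally) ordered by divisibility. *)

(* Defs.v *)
From HB Require Import structures.
From mathcomp Require Import all_boot all_order all_algebra.
From mathcomp Require Import boolp classical_sets.
From mathcomp.multinomials Require Import mpoly.

Set Implicit Arguments.
Unset Strict Implicit.
Unset Printing Implicit Defensive.

Import GRing.Theory.
Local Open Scope classical_set_scope.
Local Open Scope ring_scope.

(* Sets of binomials are classical sets of polynomials. "A binomial is
   identified with its opposite" is rendered by making each of these sets
   closed under opposite; [upto_sign] is used where the defining condition is
   not already symmetric. *)

Definition generated_monoid (s : seq nat) : set nat :=
  [set m | exists u : nat -> nat, m = (\sum_(x <- s) u x * x)%N].

Definition numerical_semigroup (S : set nat) : Prop :=
  exists s : seq nat,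
    [/\ forall x, x \in s -> (0 < x)%N,
        \big[gcdn/0%N]_(x <- s) x = 1%N
      & S = generated_monoid s].

Definition minimally_generated n (S : set nat) (A : n.-tuple nat) : Prop :=
  [/\ uniq A,
      forall x, x \in A -> (0 < x)%N,
      S = generated_monoid A
    & forall s : seq nat, {subset s <= A} -> S = generated_monoid s ->
        {subset A <= s}].

Definition Adeg n (A : n.-tuple nat) (u : 'X_{1..n}) : nat :=
  (\sum_(i < n) u i * tnth A i)%N.

Section Ideals.
Variables (n : nat) (K : fieldType).

Definition ideal_gen (G : set {mpoly K[n]}) : set {mpoly K[n]} :=
  [set p | exists s : seq ({mpoly K[n]} * {mpoly K[n]}),
      (forall cg, cg \in s -> G cg.2) /\ p = \sum_(cg <- s) cg.1 * cg.2].

Definition upto_sign (G : set {mpoly K[n]}) : set {mpoly K[n]} :=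
  [set p | G p \/ G (- p)].

Definition monomial_order (le : rel 'X_{1..n}) : Prop :=
  [/\ reflexive le /\ antisymmetric le, transitive le, total le,
      forall u, le 0%MM u
    & forall u v w, le u v -> le (u + w)%MM (v + w)%MM].

Definition leading_monomial (le : rel 'X_{1..n}) (p : {mpoly K[n]})
    (m : 'X_{1..n}) : Prop :=
  m \in msupp p /\ forall m', m' \in msupp p -> le m' m.

Definition leading_monomials (le : rel 'X_{1..n}) (G : set {mpoly K[n]}) :
    set {mpoly K[n]} :=
  [set q | exists p m, [/\ G p, leading_monomial le p m & q = 'X_[K, m]]].

Definition groebner_basis (le : rel 'X_{1..n}) (I : set {mpoly K[n]})
    (G : seq {mpoly K[n]}) : Prop :=
  (forall g, g \in G -> I g) /\
  ideal_gen (leading_monomials le [set` G]) =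
    ideal_gen (leading_monomials le I).

(* [(m' <= t)%MM] is divisibility of monomials. The zero polynomial has no
   leading monomial, hence is excluded by the first condition. *)
Definition reduced_groebner_basis (le : rel 'X_{1..n}) (I : set {mpoly K[n]})
    (G : seq {mpoly K[n]}) : Prop :=
  [/\ groebner_basis le I G,
      forall g, g \in G -> exists m, leading_monomial le g m /\ g@_m = 1
    & forall g g' m' t, g \in G -> g' \in G -> g' != g ->
        leading_monomial le g' m' -> t \in msupp g -> ~~ (m' <= t)%MM].

End Ideals.

Section Toric.
Variables (K : fieldType) (n : nat) (A : n.-tuple nat).

Definition toric_ideal : set {mpoly K[n]} :=
  ideal_gen [set p | exists u v : 'X_{1..n},
                       Adeg A u = Adeg A v /\ p = 'X_[K, u] - 'X_[v]].

Definition toric_binomial (u v : 'X_{1..n}) : Prop :=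
  toric_ideal ('X_[K, u] - 'X_[v]).

Definition nonzero_toric_binomial (u v : 'X_{1..n}) : Prop :=
  toric_binomial u v /\ 'X_[K, u] - 'X_[v] != 0.

Definition binomial_generating_set (B : set {mpoly K[n]}) : Prop :=
  (forall p, B p ->
     exists u v : 'X_{1..n}, toric_binomial u v /\ p = 'X_[K, u] - 'X_[v])
  /\ ideal_gen B = toric_ideal.

Definition markov_basis (B : set {mpoly K[n]}) : Prop :=
  binomial_generating_set B /\
  forall B', B' `<=` B -> binomial_generating_set B' -> B' = B.

(* Replacing an element of a Markov basis by its opposite yields a Markov
   basis, so this union is closed under opposite. *)
Definition universal_markov_basis : set {mpoly K[n]} :=
  [set p | exists B, markov_basis B /\ B p].

Definition betti_degree (d : nat) : Prop :=
  exists (B : set {mpoly K[n]}) (u v : 'X_{1..n}),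
    [/\ markov_basis B, B ('X_[K, u] - 'X_[v]) & d = Adeg A u].

Definition betti_divisible : Prop :=
  forall d d', betti_degree d -> betti_degree d' ->
    (d %| d')%N \/ (d' %| d)%N.

Definition primitive_binomial (u v : 'X_{1..n}) : Prop :=
  nonzero_toric_binomial u v /\
  forall w z : 'X_{1..n}, nonzero_toric_binomial w z ->
    (w <= u)%MM -> (z <= v)%MM -> 'X_[K, w] - 'X_[z] = 'X_[K, u] - 'X_[v].

Definition graver_basis : set {mpoly K[n]} :=
  [set p | exists u v : 'X_{1..n}, primitive_binomial u v /\ p = 'X_[K, u] - 'X_[v]].

Definition universal_groebner_basis : set {mpoly K[n]} :=
  upto_sign [set p | exists (le : rel 'X_{1..n}) (G : seq {mpoly K[n]}),
      [/\ monomial_order le, reduced_groebner_basis le toric_ideal G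
        & p \in G]].

Definition supp (u : 'X_{1..n}) : {set 'I_n} := [set i | u i != 0%N]%SET.

(* Null entries do not affect the gcd. *)
Definition irreducible_binomial (u v : 'X_{1..n}) : Prop :=
  [/\ toric_binomial u v, [disjoint supp u & supp v]%B
    & \big[gcdn/0%N]_(i < n) (u i + v i)%N = 1%N].

Definition circuits : set {mpoly K[n]} :=
  [set p | exists u v : 'X_{1..n},
      [/\ irreducible_binomial u v,
          forall w z : 'X_{1..n}, nonzero_toric_binomial w z ->
            ~~ (supp w :|: supp z \proper supp u :|: supp v)
        & p = 'X_[K, u] - 'X_[v]]].

Definition critical_multiple (i : 'I_n) (c : nat) : Prop :=
  (0 < c)%N /\
  generated_monoid [seq tnth A j | j <- enum 'I_n & j != i] (c * tnth A i)%N.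

Definition critical_exponent (i : 'I_n) (c : nat) : Prop :=
  critical_multiple i c /\
  forall c', critical_multiple i c' -> (c <= c')%N.

Definition critical_binomials : set {mpoly K[n]} :=
  upto_sign [set p | exists (i : 'I_n) (c : nat) (r : 'X_{1..n}),
      [/\ critical_exponent i c, r i = 0%N, (c * tnth A i)%N = Adeg A r
        & p = 'X_i ^+ c - 'X_[K, r]]].

End Toric.

Arguments toric_ideal K {n} A _.
Arguments universal_markov_basis K {n} A _.
Arguments graver_basis K {n} A _.
Arguments universal_groebner_basis K {n} A _.
Arguments circuits K {n} A _.
Arguments critical_binomials K {n} A _.

(* Main.v *)
From Stdlib Require Import Relations.
Require Import Defs.
From mathcomp Require Import all_boot all_order all_algebra.
From mathcomp Require Import zify.
From mathcomp Require Import boolp classical_sets.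
From mathcomp.multinomials Require Import mpoly.

(** The fiber of a degree is the set of monomials of that degree; it falls into
    connected components when two monomials sharing a variable are joined.
    Binomials whose sides lie in distinct components of a fiber ([separated]
    pairs) are exactly the elements of Markov bases, and their degrees are the
    Betti degrees.

    Let [c i] be the critical exponent of [x_i] and [C i] the degree of the
    critical power of [x_i]. That power is alone in its component
    ([crit_isolated]), so critical binomials belong to Markov bases and every
    [C i] is a Betti degree. If Betti degrees are ordered by divisibility, the
    [C i] form a chain, and [C i] divides every Betti degree whose fiber has a
    monomial involving [x_i] ([C_dvd_separated]). Induction on the degree then
    shows that exponents modulo the [c i] depend only on the degree
    ([fiber_congr]). Hence two monomials [u], [v] of equal degree without common
    variable are products of critical powers, whose degrees belong to a
    divisibility chain; removing small ones greedily from one side, one obtains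
    a divisor with the degree [C j] of a critical power that divides the other
    side ([disjoint_pair]). If [u - v] is primitive it must be that critical
    binomial. Since elements of Markov bases are always primitive
    ([separated_primitive]), critical binomials, the universal Markov basis and
    the Graver basis coincide.

    An element of a reduced Groebner basis is [u - v] with [v] standard and [u]
    minimal among the nonstandard monomials ([reduced_groebner_element]). Their
    proper divisors are standard, so distinct ones have distinct degrees, and
    [disjoint_pair] now gives that one side is a critical power of some [x_j];
    the same greedy argument shows that the other side is a power of a single
    variable ([crit_fiber_pure]). Such binomials are exactly the circuits
    ([circuitsP]). Conversely, an order in which [x_i] comes last puts a given
    circuit of [x_i] and [x_j] into a reduced Groebner basis, whose finiteness
    follows from the description of its elements just given. *)

Set Implicit Arguments.
Unset Strict Implicit.
Unset Printing Implicit Defensive.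

Import GRing.Theory.
Local Open Scope classical_set_scope.

(** * Monomials *)

Section Monomials.
Variable n : nat.
Implicit Types (u v : 'X_{1..n}) (i j l : 'I_n).

Lemma pure_lem i (k : nat) u : ((U_(i) *+ k)%MM <= u)%MM = (k <= u i)%N.
Proof.
apply/mnm_lepP/idP => [/(_ i)|ku j].
  by rewrite mulmnE mnm1E eqxx mul1n.
by rewrite mulmnE mnm1E; case: eqP => [<-|_]; rewrite ?mul1n.
Qed.

Lemma lem0m u : (0 <= u)%MM.
Proof. by apply/mnm_lepP => i; rewrite mnm0E. Qed.

Lemma mnm_neq0P u : reflect (exists i, u i != 0%N) (u != 0%MM).
Proof.
apply: (iffP idP) => [u0|[i]]; last by apply: contraNneq => ->; rewrite mnm0E.
apply/existsP; apply: contraNT u0 => /existsPn u0.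
by apply/eqP/mnmP => i; rewrite mnm0E; apply/eqP; rewrite -[_ == _]negbK.
Qed.

Lemma pureE i (k : nat) j : (U_(i) *+ k)%MM j = if i == j then k else 0%N.
Proof. by rewrite mulmnE mnm1E; case: eqP; rewrite ?mul1n. Qed.

Lemma lem_anti u v : (u <= v)%MM -> (v <= u)%MM -> u = v.
Proof.
move=> /mnm_lepP uv /mnm_lepP vu; apply/mnmP => i.
by apply/eqP; rewrite eqn_leq uv vu.
Qed.

Lemma pure_of_supp i u : (forall l, l != i -> u l = 0%N) -> u = (U_(i) *+ u i)%MM.
Proof.
by move=> ui; apply/mnmP => l; rewrite pureE; have [->//|/ui] := eqVneq l i.
Qed.

End Monomials.

(** * Degrees and connected components of fibers *)

Section Degree.
Variables (n : nat) (A : n.-tuple nat).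
Implicit Types (u v w r : 'X_{1..n}) (i j k l : 'I_n).

Lemma AdegD u v : Adeg A (u + v)%MM = (Adeg A u + Adeg A v)%N.
Proof.
by rewrite /Adeg -big_split; apply: eq_bigr => i _; rewrite mnmDE mulnDl.
Qed.

Lemma Adeg_pure i (k : nat) : Adeg A (U_(i) *+ k)%MM = (k * tnth A i)%N.
Proof.
rewrite /Adeg (bigD1 i) //= big1 => [|j ji]; rewrite mulmnE mnm1E.
  by rewrite eqxx mul1n addn0.
by rewrite eq_sym (negbTE ji).
Qed.

Lemma AdegMn u (k : nat) : Adeg A (u *+ k)%MM = (k * Adeg A u)%N.
Proof.
by rewrite /Adeg big_distrr; apply: eq_bigr => i _; rewrite mulmnE /= mulnAC mulnC.
Qed.

Lemma Adeg_le w u : (w <= u)%MM -> (Adeg A w <= Adeg A u)%N.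
Proof. by move=> wu; rewrite -(submK wu) AdegD leq_addl. Qed.

Lemma AdegB w u : (w <= u)%MM -> Adeg A (u - w)%MM = (Adeg A u - Adeg A w)%N.
Proof. by move=> wu; rewrite -{2}(submK wu) AdegD addnK. Qed.

Lemma Adeg_ge_term u i : (u i * tnth A i <= Adeg A u)%N.
Proof. by rewrite /Adeg (bigD1 i) //= leq_addr. Qed.

(** Two monomials of a fiber that share a variable differ by a multiple of a
    binomial of smaller degree; a component thus gathers the monomials that are
    congruent modulo the part of the toric ideal of smaller degree. *)
Definition fiber_step u v :=
  Adeg A u = Adeg A v /\ exists k, u k != 0%N /\ v k != 0%N.

Definition connected := clos_refl_sym_trans 'X_{1..n} fiber_step.

(** These are the pairs whose binomials belong to some Markov basis, and their
    degrees are the Betti degrees: see [universal_markovP] and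
    [separated_betti]. *)
Definition separated u v := Adeg A u = Adeg A v /\ ~ connected u v.

Lemma connected_Adeg u v : connected u v -> Adeg A u = Adeg A v.
Proof. by elim=> [? ? []|//|? ? _ ->|? ? ? _ -> _ ->]. Qed.

Lemma connected_sym u v : connected u v -> connected v u.
Proof. exact: rst_sym. Qed.

Lemma separated_sym u v : separated u v -> separated v u.
Proof. by case=> uv nc; split=> // /connected_sym. Qed.

Lemma separated_neq u v : separated u v -> u != v.
Proof. by case=> _ nc; apply/eqP => uv; apply: nc; rewrite uv; exact: rst_refl. Qed.

Hypothesis Apos : forall i, (0 < tnth A i)%N.

Lemma Adeg_eq0 u : (Adeg A u == 0%N) = (u == 0%MM).
Proof.
apply/idP/eqP => [|->]; last by rewrite -(mulm0n u) AdegMn.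
move=> /eqP u0; apply/mnmP => i; rewrite mnm0E.
have := Adeg_ge_term u i; rewrite u0 leqn0 muln_eq0 => /orP[/eqP //|/eqP ai].
by have := Apos i; rewrite ai.
Qed.

Lemma Adeg_gt0 u i : u i != 0%N -> (0 < Adeg A u)%N.
Proof. by move=> ui; rewrite lt0n Adeg_eq0; apply/mnm_neq0P; exists i. Qed.

Lemma lem_Adeg_eq w u : (w <= u)%MM -> Adeg A w = Adeg A u -> w = u.
Proof.
move=> wu dwu; have /eqP : Adeg A (u - w)%MM = 0%N by rewrite AdegB // dwu subnn.
by rewrite Adeg_eq0 => /eqP uw; rewrite -(submK wu) uw add0m.
Qed.

Lemma separated_disjoint u v k : separated u v -> u k != 0%N -> v k = 0%N.
Proof.
move=> [duv nc] uk; apply/eqP; apply: contrapT => /negP vk; apply: nc.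
by apply: rst_step; split=> //; exists k.
Qed.

Section FiberInduction.
Variable R : relation 'X_{1..n}.
Hypothesis R_equiv : equivalence _ R.
Hypothesis R_add : forall k u v, R u v -> R (U_(k) + u)%MM (U_(k) + v)%MM.

(** Dividing two adjacent monomials by a common variable lowers the degree, so
    a multiplicative equivalence that holds in smaller degrees holds inside the
    components. *)
Lemma connected_sub d u v :
  (forall u' v', Adeg A u' = Adeg A v' -> (Adeg A u' < d)%N -> R u' v') ->
  connected u v -> Adeg A u = d -> R u v.
Proof.
case: R_equiv => Rrefl Rtrans Rsym IH; elim=> {u v}.
- move=> u v [duv [k [uk vk]]] du.
  have Uu : (U_(k) <= u)%MM by rewrite lep1mP.
  have Uv : (U_(k) <= v)%MM by rewrite lep1mP.
  rewrite -(submK Uu) -(submK Uv) ![(_ - _ + _)%MM]addmC; apply: R_add.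
  have := AdegB Uu; have := AdegB Uv; have := Adeg_le Uu.
  have := Adeg_pure k 1; rewrite mulm1n mul1n => ->; have := Apos k.
  by move=> *; apply: IH; lia.
- by move=> *; exact: Rrefl.
- move=> u v uv Ruv dv; apply: Rsym; apply: Ruv.
  by rewrite (connected_Adeg uv).
- move=> u v w uv Ruv vw Rvw du; apply: Rtrans (Ruv du) (Rvw _).
  by rewrite -(connected_Adeg uv).
Qed.

(** Equal degrees are generated by separated pairs: strong induction on the
    degree, with [connected_sub] inside the components, leaves only the pairs
    in distinct components. *)
Lemma fiber_ind :
  (forall u v,
     (forall u' v', Adeg A u' = Adeg A v' -> (Adeg A u' < Adeg A u)%N -> R u' v') ->
     separated u v -> R u v) ->
  forall u v, Adeg A u = Adeg A v -> R u v.
Proof.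
move=> Rsep u v; move: {2}(Adeg A u) (erefl (Adeg A u)) => d.
elim/ltn_ind: d u v => d IH u v du duv.
have IH' u' v' : Adeg A u' = Adeg A v' -> (Adeg A u' < Adeg A u)%N -> R u' v'.
  by move=> e lt; apply: (IH (Adeg A u')) => //; rewrite -du.
case: (pselect (connected u v)) => [uv|nc]; first exact: connected_sub IH' uv _.
exact: Rsep.
Qed.

End FiberInduction.

End Degree.

(** * Critical exponents and Betti divisibility *)

Section Critical.
Variables (n : nat) (A : n.-tuple nat).
Hypothesis Apos : forall i, (0 < tnth A i)%N.
Implicit Types (u v w r : 'X_{1..n}) (i j k l : 'I_n).

Variable c : 'I_n -> nat.
Hypothesis c_gt0 : forall i, (0 < c i)%N.
Hypothesis c_relation : forall i, exists r, r i = 0%N /\ Adeg A r = (c i * tnth A i)%N.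
Hypothesis c_min : forall i (k : nat) r,
  (0 < k)%N -> r i = 0%N -> Adeg A r = (k * tnth A i)%N -> (c i <= k)%N.

Notation C i := (c i * tnth A i)%N.
Notation P i := (U_(i) *+ c i)%MM.

Lemma C_gt0 i : (0 < C i)%N.
Proof. by rewrite muln_gt0 c_gt0 Apos. Qed.

(** Cancelling [x_i] in another monomial of degree [C i] would give a smaller
    multiple of the [i]-th generator in the monoid of the others; hence the
    pure power is alone in its component. *)
Lemma crit_isolated i u : Adeg A u = C i -> u i != 0%N -> u = P i.
Proof.
move=> du ui; case: (leqP (c i) (u i)) => [le|lt].
  by apply/esym/(lem_Adeg_eq Apos); rewrite ?pure_lem // Adeg_pure du.
have le : ((U_(i) *+ u i)%MM <= u)%MM by rewrite pure_lem.
have := @c_min i (c i - u i) (u - U_(i) *+ u i)%MM.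
rewrite AdegB // Adeg_pure du mnmBE pureE eqxx subnn -mulnBl.
by move=> /(_ _ erefl erefl); lia.
Qed.

Lemma connected_crit i u : connected A (P i) u -> u = P i.
Proof.
suff H s t : connected A s t -> s = P i <-> t = P i by move=> /H [/(_ erefl)].
elim=> {s t} [s t [dst [k [sk tk]]]|//|s t _ ->//|s t w _ -> _ ->//].
have aux x y : Adeg A x = Adeg A y -> x k != 0%N -> y k != 0%N -> x = P i -> y = P i.
  move=> dxy xk yk xP; apply: crit_isolated; first by rewrite -dxy xP Adeg_pure.
  by move: xk; rewrite xP pureE; have [->|] := eqVneq i k.
by split; apply: aux.
Qed.

Lemma crit_separated i r : r i = 0%N -> Adeg A r = C i -> separated A (P i) r.
Proof.
move=> ri dr; split; first by rewrite Adeg_pure dr.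
move=> /connected_crit rP; move: ri (c_gt0 i); rewrite rP pureE eqxx => ->.
by rewrite ltnn.
Qed.

Hypothesis betti_dvd : forall u v u' v', separated A u v -> separated A u' v' ->
  (Adeg A u %| Adeg A u')%N \/ (Adeg A u' %| Adeg A u)%N.

Lemma C_dvd_of_le i j : (C i <= C j)%N -> (C i %| C j)%N.
Proof.
have [ri [ri0 dri]] := c_relation i; have [rj [rj0 drj]] := c_relation j.
have := betti_dvd (crit_separated ri0 dri) (crit_separated rj0 drj).
rewrite !Adeg_pure => -[//|ji ij]; suff -> : C i = C j by [].
by apply/eqP; rewrite eqn_leq ij dvdn_leq ?C_gt0.
Qed.

(** [C i] is a Betti degree, hence comparable with the degree [d] of [u]. If
    [C i = k * d], then [u ^ k] lies in the fiber of [C i] and contains [x_i],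
    so by [crit_isolated] [u] is a power of [x_i]. But [v] avoids [x_i], so
    this power is at least the critical one and [C i <= d], whence equality. *)
Lemma C_dvd_separated u v i : separated A u v -> u i != 0%N -> (C i %| Adeg A u)%N.
Proof.
move=> uv ui; have [r [ri dr]] := c_relation i.
have := betti_dvd (crit_separated ri dr) uv; rewrite Adeg_pure => -[//|/dvdnP[k kE]].
have kuP : (u *+ k)%MM = P i.
  apply: crit_isolated; first by rewrite AdegMn kE.
  rewrite mulmnE muln_eq0 negb_or ui /=; apply/eqP => k0.
  by have := C_gt0 i; rewrite kE k0.
have k0 : (0 < k)%N by have := C_gt0 i; rewrite kE muln_gt0 => /andP[].
have uE : u = (U_(i) *+ u i)%MM.
  apply/mnmP => j; rewrite pureE; case: eqP => [->//|/eqP ij].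
  have /eqP := congr1 (fun m : 'X_{1..n} => m j) kuP; rewrite mulmnE pureE (negbTE ij).
  by rewrite muln_eq0 => /orP[/eqP//|/eqP k0']; rewrite k0' in k0.
have vi := separated_disjoint uv ui; case: uv => duv _.
have du : Adeg A u = (u i * tnth A i)%N by rewrite {1}uE Adeg_pure.
have cu : (c i <= u i)%N by apply: (@c_min i _ v); rewrite ?lt0n // -duv.
suff -> : C i = Adeg A u by [].
apply/eqP; rewrite eqn_leq {1}du leq_pmul2r // cu /= kE.
by rewrite leq_pmull.
Qed.

Definition exponents_congr u v := forall l, u l = v l %[mod c l].

Lemma exponents_congr_equiv : equivalence _ exponents_congr.
Proof.
by split=> [u l|u v w uv vw l|u v uv l] //; rewrite uv.
Qed.

Lemma exponents_congr_add l u v : exponents_congr u v ->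
  exponents_congr (U_(l) + u)%MM (U_(l) + v)%MM.
Proof. by move=> uv k; rewrite !mnmDE -modnDmr uv modnDmr. Qed.

(** The residues of the exponents modulo the critical exponents depend only on
    the degree. By [fiber_ind] only a separated pair matters. There [C l]
    divides the degree for each [x_l] in [u], so the fiber contains a power of
    [x_l] whose exponent is a multiple of [c l]; it is adjacent to [u], and the
    induction hypothesis transfers its residues, all zero at [l], to [u]. *)
Lemma fiber_congr u v : Adeg A u = Adeg A v -> exponents_congr u v.
Proof.
apply: (fiber_ind Apos exponents_congr_equiv exponents_congr_add).
move=> {}u {}v IH uv.
have dvd x y : Adeg A x = Adeg A u -> separated A x y -> forall l, (c l %| x l)%N.
  move=> dx xy l.
  have [/eqP ->|xl] := boolP (x l == 0%N); first exact: dvdn0.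
  have := C_dvd_separated xy xl; rewrite dvdn_eq => /eqP.
  set q := (_ %/ _)%N => qE.
  have e : Adeg A x = (q * c l * tnth A l)%N by rewrite -mulnA qE.
  (* The pure power of the same degree shares the variable l with x. *)
  have : exponents_congr x (U_(l) *+ (q * c l))%MM.
    apply: (connected_sub Apos exponents_congr_equiv exponents_congr_add IH) => //.
    apply: rst_step; split; first by rewrite Adeg_pure.
    exists l; split=> //; rewrite pureE eqxx -lt0n.
    have := Adeg_gt0 Apos xl; rewrite e !muln_gt0 => /andP[/andP[-> ->]] //.
  by move=> /(_ l); rewrite pureE eqxx modnMl => /eqP.
move=> l; have [duv _] := uv.
have /eqP -> := dvd u v erefl uv l.
by have /eqP -> := dvd v u (esym duv) (separated_sym uv) l.
Qed.

Definition disjoint_mnm u v := forall l, u l = 0%N \/ v l = 0%N.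

Lemma fiber_disjoint_dvd u v : Adeg A u = Adeg A v -> disjoint_mnm u v ->
  forall l, (c l %| u l)%N.
Proof.
move=> duv dis l; case: (dis l) => [->|vl]; first exact: dvdn0.
by have := fiber_congr duv l; rewrite vl mod0n => /eqP.
Qed.

(** The degrees [C l] form a chain for divisibility. As long as the degree of
    [u] exceeds [m], both are multiples of the least [C l] over the variables
    of [u], so dividing [u] by that critical power does not go below [m]. *)
Lemma subdegree u m :
  (forall l, (c l %| u l)%N) -> (forall l, u l != 0%N -> (C l %| m)%N) ->
  (m <= Adeg A u)%N -> exists w, (w <= u)%MM /\ Adeg A w = m.
Proof.
move: {2}(Adeg A u) (leqnn (Adeg A u)) => d.
elim: d u => [|d IH] u du cu Cm mu.
  by exists u; split; [exact: lepm_refl | lia].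
move: mu; rewrite leq_eqVlt => /orP[/eqP ->|mu].
  by exists u; split; [exact: lepm_refl |].
have /(mnm_neq0P u) [l0 ul0] : u != 0%MM by rewrite -(Adeg_eq0 Apos); lia.
have [l ul lmin] := arg_minnP (P := fun l => u l != 0%N) (fun l => C l) ul0.
have Cu : (C l %| Adeg A u)%N.
  rewrite /Adeg; apply: (big_ind (fun x => C l %| x)%N) =>
    [|x y|k _]; [exact: dvdn0 | exact: dvdn_add |].
  have [->|/lmin lk] := eqVneq (u k) 0%N; first exact: dvdn0.
  apply: dvdn_trans (C_dvd_of_le lk) _; exact: dvdn_mul.
have Pu : (P l <= u)%MM by rewrite pure_lem dvdn_leq // lt0n.
have dw := AdegB A Pu; rewrite Adeg_pure in dw.
have lel : (C l <= Adeg A u - m)%N.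
  by rewrite dvdn_leq ?subn_gt0 // dvdn_sub // Cm.
have [||||w [wu <-]] := IH (u - P l)%MM.
- by rewrite dw; have := C_gt0 l; lia.
- move=> k; rewrite mnmBE pureE; case: eqP => [<-|_]; last by rewrite subn0.
  by rewrite dvdn_sub.
- move=> k; rewrite mnmBE pureE => ukl; apply: Cm; apply: contraNneq ukl => ->.
  by rewrite sub0n.
- by rewrite dw; lia.
by exists w; split=> //; apply: lepm_trans wu (lem_subr _ _).
Qed.

Lemma disjoint_pair_aux u v j : Adeg A u = Adeg A v -> disjoint_mnm u v ->
  v j != 0%N -> (forall l, u l != 0%N -> (C l <= C j)%N) ->
  (P j <= v)%MM /\ exists w, (w <= u)%MM /\ Adeg A w = C j.
Proof.
move=> duv dis vj jmax.
have dis' : disjoint_mnm v u by move=> l; case: (dis l); [right | left].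
have Pv : (P j <= v)%MM.
  by rewrite pure_lem dvdn_leq ?lt0n // (fiber_disjoint_dvd (esym duv) dis').
split=> //; apply: subdegree; first exact: fiber_disjoint_dvd duv dis.
  by move=> l /jmax /C_dvd_of_le.
by rewrite duv -(Adeg_pure A j (c j)) Adeg_le.
Qed.

(** The index [j] maximizes [C j] over the variables of both monomials. By
    [fiber_disjoint_dvd] the critical power of [x_j] divides one side, and
    [subdegree] finds a divisor of the same degree on the other side. *)
Lemma disjoint_pair u v : Adeg A u = Adeg A v -> disjoint_mnm u v -> u != v ->
  exists j w, [/\ Adeg A w = C j &
    ([/\ (w <= u)%MM, (P j <= v)%MM & u j = 0%N]
     \/ [/\ (w <= v)%MM, (P j <= u)%MM & v j = 0%N])].
Proof.
move=> duv dis uv.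
have /existsP[l0 l0P] : [exists l, (u l != 0%N) || (v l != 0%N)].
  apply: contraNT uv => /existsPn H; apply/eqP/mnmP => l.
  by have := H l; rewrite negb_or !negbK => /andP[/eqP -> /eqP ->].
have [j jP jmax] := arg_maxnP
  (P := fun l => (u l != 0%N) || (v l != 0%N)) (fun l => C l) l0P.
exists j; case/orP: jP => [uj|vj].
  have dis' : disjoint_mnm v u by move=> l; case: (dis l); [right | left].
  have [|Pu [w [wv dw]]] := disjoint_pair_aux (esym duv) dis' uj.
    by move=> l vl; apply: jmax; rewrite vl orbT.
  by exists w; split=> //; right; split=> //; case: (dis j) uj => [->|].
have [|Pv [w [wu dw]]] := disjoint_pair_aux duv dis vj.
  by move=> l ul; apply: jmax; rewrite ul.
by exists w; split=> //; left; split=> //; case: (dis j) vj => [|->].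
Qed.

(** If [r] involves several variables, pick [x_l] with the largest [C l]. The
    other variables of [r] have a total degree that is a positive multiple of
    [C l], so [subdegree] finds among them a divisor of degree [C l]; it and the
    critical power of [x_l] are distinct proper divisors of equal degree. *)
Lemma crit_fiber_pure j r : r j = 0%N -> Adeg A r = C j ->
  (forall w w', (w <= r)%MM -> (w' <= r)%MM -> w != r -> w' != r ->
     Adeg A w = Adeg A w' -> w = w') ->
  exists i (k : nat), r = (U_(i) *+ k)%MM.
Proof.
move=> rj dr inj.
have sepr := separated_sym (crit_separated rj dr).
have disr : disjoint_mnm r (P j).
  by move=> l; rewrite pureE; case: eqP => [<-|_]; [left | right].
have cr : forall l, (c l %| r l)%N.
  by apply: (fiber_disjoint_dvd _ disr); rewrite dr Adeg_pure.
have /(mnm_neq0P r)[l0 rl0] : r != 0%MM by rewrite -(Adeg_eq0 Apos) dr -lt0n C_gt0.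
have [l rl lmax] := arg_maxnP (P := fun l => r l != 0%N) (fun l => C l) rl0.
exists l, (r l).
have lr : (U_(l) *+ r l <= r)%MM by rewrite pure_lem.
have [/eqP z|nz] := boolP (r - U_(l) *+ r l == 0)%MM.
  by rewrite -[LHS](submK lr) z add0m.
exfalso.
have [|||w [wr' dw]] := @subdegree (r - U_(l) *+ r l)%MM (C l).
- move=> k; rewrite mnmBE pureE; case: eqP => [<-|_]; last by rewrite subn0.
  by rewrite subnn dvdn0.
- move=> k; rewrite mnmBE => rk; apply: C_dvd_of_le; apply: lmax.
  by apply: contraNneq rk => ->.
- rewrite dvdn_leq ?lt0n ?(Adeg_eq0 Apos) // AdegB // Adeg_pure.
  by rewrite dvdn_sub ?(C_dvd_separated sepr rl) // dvdn_mul.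
have wl : w l = 0%N.
  have /mnm_lepP/(_ l) := wr'; rewrite mnmBE pureE eqxx subnn leqn0.
  by move/eqP.
have wr : (w <= r)%MM by apply: lepm_trans wr' (lem_subr _ _).
have Pr : (P l <= r)%MM by rewrite pure_lem dvdn_leq ?lt0n.
have wP : w = P l.
  apply: inj => //; last by rewrite dw Adeg_pure.
    by apply: contraNneq rl => <-; rewrite wl.
  apply: contraNneq nz => PE; apply/eqP/mnmP => k; rewrite mnmBE mnm0E -PE !pureE eqxx.
  by case: (l == k); rewrite subnn.
by have := c_gt0 l; move: wl; rewrite wP pureE eqxx => ->.
Qed.

End Critical.

(** * Ideals generated by pure binomials *)

Section BinomialIdeals.
Variables (n : nat) (K : fieldType).
Local Open Scope ring_scope.
Implicit Types (p q : {mpoly K[n]}) (B G : set {mpoly K[n]}).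
Implicit Types (a b s t u v w m : 'X_{1..n}).

Lemma ideal_genD G p q : ideal_gen G p -> ideal_gen G q -> ideal_gen G (p + q).
Proof.
move=> [s1 [G1 ->]] [s2 [G2 ->]]; exists (s1 ++ s2); rewrite big_cat; split=> //.
by move=> cg; rewrite mem_cat => /orP[/G1|/G2].
Qed.

Lemma ideal_genM G q p : ideal_gen G p -> ideal_gen G (q * p).
Proof.
move=> [s [Gs ->]]; exists [seq (q * cg.1, cg.2) | cg <- s]; split.
  by move=> cg /mapP [x xs ->] /=; apply: Gs.
by rewrite big_map big_distrr; apply: eq_bigr => cg _ /=; rewrite mulrA.
Qed.

Lemma ideal_gen0 G : ideal_gen G 0.
Proof. by exists [::]; split=> //; rewrite big_nil. Qed.

Lemma ideal_genN G p : ideal_gen G p -> ideal_gen G (- p).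
Proof. by rewrite -mulN1r; exact: ideal_genM. Qed.

Lemma ideal_gen_sub G : G `<=` ideal_gen G.
Proof.
move=> p Gp; exists [:: (1, p)]; split; last by rewrite big_seq1 mul1r.
by move=> cg; rewrite inE => /eqP ->.
Qed.

Lemma ideal_gen_min B G : B `<=` ideal_gen G -> ideal_gen B `<=` ideal_gen G.
Proof.
move=> BG p [s [Bs ->]]; rewrite big_seq.
apply: (big_ind (ideal_gen G)); [exact: ideal_gen0 | exact: ideal_genD |].
by move=> cg /Bs /BG; exact: ideal_genM.
Qed.

(** A linear form on polynomials: when [C] is stable under the moves defined by
    a set of pure binomials, it vanishes on the ideal they generate, which is
    how nonmembership is detected. *)
Definition coef_sum (C : set 'X_{1..n}) p : K :=
  \sum_(m <- msupp p | `[<C m>]) p@_m.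

(** Sums over a common list make the additivity of [coef_sum] visible, as the
    support of a sum may be smaller than the union of the supports. *)
Lemma coef_sum_widen C p (r : seq 'X_{1..n}) : uniq r -> {subset msupp p <= r} ->
  coef_sum C p = \sum_(m <- r | `[<C m>]) p@_m.
Proof.
move=> ur pr; rewrite [RHS](bigID (mem (msupp p))) /= [X in _ + X]big1 => [|m].
  rewrite addr0 -big_filter_cond [RHS]big_filter_cond /coef_sum.
  rewrite (eq_bigl (fun m => (m \in msupp p) && `[<C m>])) => [|m]; last first.
    by rewrite andbC.
  rewrite -[RHS]big_filter_cond; apply: perm_big; apply: uniq_perm.
  - exact: msupp_uniq.
  - exact: filter_uniq.
  - by move=> m; rewrite mem_filter; case: (boolP (m \in _)) => // /pr ->.
by case/andP=> _; exact: memN_msupp_eq0.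
Qed.

Lemma coef_sumD C p q : coef_sum C (p + q) = coef_sum C p + coef_sum C q.
Proof.
pose r := undup (msupp (p + q) ++ msupp p ++ msupp q).
have ur : uniq r by exact: undup_uniq.
rewrite !(@coef_sum_widen C _ r) //; last 3 first.
- by move=> m; rewrite mem_undup !mem_cat => ->; rewrite ?orbT.
- by move=> m; rewrite mem_undup !mem_cat => ->; rewrite ?orbT.
- by move=> m; rewrite mem_undup !mem_cat => ->; rewrite ?orbT.
by rewrite -big_split; apply: eq_bigr => m _; rewrite mcoeffD.
Qed.

Lemma coef_sumZ C (x : K) p : coef_sum C (x *: p) = x * coef_sum C p.
Proof.
rewrite (@coef_sum_widen C _ (msupp p)) ?msupp_uniq //; last first.
  move=> m; rewrite !mcoeff_msupp mcoeffZ; apply: contraNneq => ->.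
  by rewrite mulr0.
by rewrite /coef_sum big_distrr; apply: eq_bigr => m _; rewrite mcoeffZ.
Qed.

Lemma coef_sum0 C : coef_sum C 0 = 0.
Proof. by rewrite -(scale0r 0) coef_sumZ mul0r. Qed.

Lemma coef_sumX C m : coef_sum C 'X_[m] = `[<C m>]%:R.
Proof.
rewrite /coef_sum msuppX big_mkcond big_seq1 mcoeffX eqxx.
by case: `[<_>].
Qed.

Lemma coef_sum_binomial C a b :
  coef_sum C ('X_[a] - 'X_[b]) = `[<C a>]%:R - `[<C b>]%:R.
Proof. by rewrite -scaleN1r coef_sumD coef_sumZ !coef_sumX mulN1r. Qed.

Lemma coef_sum_ideal C B p :
  (forall q, B q -> exists a b,
     q = 'X_[a] - 'X_[b] /\ forall w, C (w + a)%MM <-> C (w + b)%MM) ->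
  ideal_gen B p -> coef_sum C p = 0.
Proof.
move=> BC [s [Bs ->]]; rewrite big_seq.
apply: (big_ind (fun q => coef_sum C q = 0)); first exact: coef_sum0.
  by move=> x y x0 y0; rewrite coef_sumD x0 y0 addr0.
move=> [f g] /Bs /= /BC[a [b [-> Cab]]].
rewrite [f]mpolyE big_distrl.
apply: (big_ind (fun q => coef_sum C q = 0)); first exact: coef_sum0.
  by move=> x y x0 y0; rewrite coef_sumD x0 y0 addr0.
move=> w _ /=; rewrite -scalerAl coef_sumZ mulrBr -!mpolyXD coef_sum_binomial.
by rewrite (asbool_equiv_eq (Cab w)) subrr mulr0.
Qed.

Definition binomial_move B s t :=
  exists w a b, [/\ B ('X_[a] - 'X_[b]), s = (w + a)%MM & t = (w + b)%MM].

Definition linked B := clos_refl_sym_trans 'X_{1..n} (binomial_move B).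

Lemma linked_equiv B : equivalence _ (linked B).
Proof.
split; [exact: rst_refl | by move=> ? ? ?; exact: rst_trans |].
by move=> ? ?; exact: rst_sym.
Qed.

Lemma linked_add B w s t : linked B s t -> linked B (w + s)%MM (w + t)%MM.
Proof.
elim=> {s t} [s t [w' [a [b [Bab -> ->]]]]|s|s t _|s r t _ sr _ rt].
- by apply: rst_step; exists (w + w')%MM, a, b; rewrite !addmA.
- exact: rst_refl.
- exact: rst_sym.
- exact: rst_trans sr rt.
Qed.

Lemma linked_ideal B s t : linked B s t -> ideal_gen B ('X_[s] - 'X_[t]).
Proof.
elim=> {s t} [s t [w [a [b [Bab -> ->]]]]|s|s t _|s r t _ sr _ rt].
- by rewrite !mpolyXD -mulrBr; apply/ideal_genM/ideal_gen_sub.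
- by rewrite subrr; exact: ideal_gen0.
- by move=> st; rewrite -opprB; exact: ideal_genN.
- by rewrite -(subrKA 'X_[r]); exact: ideal_genD.
Qed.

(** The linear form of the class of [s] vanishes on the ideal and takes the
    value 1 at the monomial [s], so [t] must lie in the same class. *)
Lemma ideal_linked B s t :
  (forall q, B q -> exists a b, q = 'X_[a] - 'X_[b]) ->
  ideal_gen B ('X_[s] - 'X_[t]) -> linked B s t.
Proof.
move=> Bbin /(@coef_sum_ideal [set m | linked B s m]) -/(_ _) H.
have {H} : coef_sum [set m | linked B s m] ('X_[s] - 'X_[t]) = 0.
  apply: H => q Bq; have [a [b qE]] := Bbin q Bq; exists a, b; split=> // w.
  have ab : linked B (w + a)%MM (w + b)%MM.
    by apply: rst_step; exists w, a, b; rewrite -qE.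
  split=> sw; first exact: rst_trans sw ab.
  by apply: rst_trans sw _; apply: rst_sym.
rewrite coef_sum_binomial /= asboolT; last exact: rst_refl.
by case: asboolP => // _ /eqP; rewrite subr0 oner_eq0.
Qed.

Lemma binomial_neq0 a b : ('X_[K, a] - 'X_[b] != 0) = (a != b).
Proof.
congr (~~ _); apply/eqP/eqP => [|->]; last by rewrite subrr.
move=> /(congr1 (mcoeff a)); rewrite mcoeffB !mcoeffX eqxx mcoeff0.
by case: eqP => [->//|_] /eqP; rewrite subr0 oner_eq0.
Qed.

(** The second case occurs in characteristic 2. *)
Lemma binomial_inj a b s t : a != b ->
  'X_[K, a] - 'X_[b] = 'X_[s] - 'X_[t] ->
  (a = s /\ b = t) \/ (a = t /\ b = s).
Proof.
move=> ab E.
have [sa|sa] := eqVneq s a.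
  left; split=> //; move: E; rewrite sa => /addrI/oppr_inj E.
  by apply/eqP; rewrite -[_ == _]negbK -binomial_neq0 E subrr eqxx.
right; have := congr1 (mcoeff a) E; rewrite !mcoeffB !mcoeffX eqxx (negbTE sa).
rewrite eq_sym (negbTE ab) subr0 sub0r.
have [ta _|_ /eqP] := eqVneq t a; last by rewrite oppr0 oner_eq0.
split=> //; have := congr1 (mcoeff b) E; rewrite ta !mcoeffB !mcoeffX eqxx (negbTE ab).
rewrite sub0r subr0 eq_sym; have [->//|_ /eqP] := eqVneq b s.
by rewrite oppr_eq0 oner_eq0.
Qed.

End BinomialIdeals.

Section ToricIdeal.
Variables (n : nat) (K : fieldType) (A : n.-tuple nat).
Local Open Scope ring_scope.
Implicit Types (p q : {mpoly K[n]}) (B : set {mpoly K[n]}).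
Implicit Types (a b s t u v w m : 'X_{1..n}).

Lemma toric_coef_sum d p :
  toric_ideal K A p -> coef_sum [set m | Adeg A m = d] p = 0.
Proof.
apply: coef_sum_ideal => q [u [v [duv ->]]]; exists u, v; split=> // w /=.
by rewrite !AdegD duv.
Qed.

Lemma toric_binomialP u v : toric_binomial K A u v <-> Adeg A u = Adeg A v.
Proof.
split=> [/(toric_coef_sum (Adeg A u))|duv]; last first.
  by apply: ideal_gen_sub; exists u, v.
rewrite coef_sum_binomial /= asboolT //; case: asboolP => // _ /eqP.
by rewrite subr0 oner_eq0.
Qed.

Lemma nonzero_toric_binomialP u v :
  nonzero_toric_binomial K A u v <-> Adeg A u = Adeg A v /\ u != v.
Proof. by rewrite /nonzero_toric_binomial toric_binomialP binomial_neq0. Qed.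

(** The coefficients of [p] over each fiber sum to zero, so no fiber meets the
    support of [p] in a single monomial. *)
Lemma toric_fiber_companion p m : toric_ideal K A p -> m \in msupp p ->
  exists m', [/\ m' \in msupp p, m' != m & Adeg A m' = Adeg A m].
Proof.
move=> Ip mp; apply: contrapT => nex.
have := toric_coef_sum (Adeg A m) Ip.
rewrite /coef_sum big_mkcond (bigD1_seq m) ?msupp_uniq //=.
rewrite asboolT // big1_seq => [|m' /andP[m'm m'p]].
  by move/eqP; rewrite addr0; apply/negP; rewrite -mcoeff_msupp.
by case: asboolP => // dm'; case: nex; exists m'.
Qed.

Lemma generating_linked B : binomial_generating_set A B ->
  forall u v, Adeg A u = Adeg A v -> linked B u v.
Proof.
move=> [Bbin BI] u v duv; apply: ideal_linked.
  by move=> q /Bbin[a [b [_ ->]]]; exists a, b.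
by rewrite BI; apply/toric_binomialP.
Qed.

Lemma linked_generating B :
  (forall p, B p -> exists u v, Adeg A u = Adeg A v /\ p = 'X_[u] - 'X_[v]) ->
  (forall u v, Adeg A u = Adeg A v -> linked B u v) -> binomial_generating_set A B.
Proof.
move=> Bbin Blink; split.
  by move=> p /Bbin[u [v [duv ->]]]; exists u, v; rewrite toric_binomialP.
apply/seteqP; split.
  by apply: ideal_gen_min => p /Bbin[u [v [duv ->]]]; apply/toric_binomialP.
by apply: ideal_gen_min => p [u [v [duv ->]]]; apply/linked_ideal/Blink.
Qed.

End ToricIdeal.

(** * Markov bases *)

Section Markov.
Variables (n : nat) (K : fieldType) (A : n.-tuple nat).
Hypothesis Apos : forall i, (0 < tnth A i)%N.
Local Open Scope ring_scope.
Implicit Types (p q : {mpoly K[n]}) (B : set {mpoly K[n]}).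
Implicit Types (a b s t u v w m : 'X_{1..n}).

(** In each fiber, joining the chosen representative of every component to that
    of one fixed component gives a spanning tree of the set of components. *)
Section Star.
Variables (rep : 'X_{1..n} -> 'X_{1..n}) (base : nat -> 'X_{1..n}).
Hypothesis rep_connected : forall m, connected A m (rep m).
Hypothesis rep_eq : forall s t, connected A s t -> rep s = rep t.
Hypothesis base_Adeg : forall m, Adeg A (base (Adeg A m)) = Adeg A m.

Notation root m := (rep (base (Adeg A m))).

Definition star_basis : set {mpoly K[n]} :=
  [set p | exists m, rep m != root m /\ p = 'X_[rep m] - 'X_[root m]].

Lemma rep_Adeg m : Adeg A (rep m) = Adeg A m.
Proof. by apply/esym/connected_Adeg. Qed.

Lemma root_Adeg m : Adeg A (root m) = Adeg A m.
Proof. by rewrite rep_Adeg base_Adeg. Qed.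

Lemma repK m : rep (rep m) = rep m.
Proof. by apply/esym/rep_eq. Qed.

(** An edge of the tree cannot be dropped: the moves that remain never leave
    the component of its endpoint [rep m]. *)
Lemma star_markov : markov_basis A star_basis.
Proof.
have gen : binomial_generating_set A star_basis.
  apply: linked_generating => [p [m [_ ->]]|].
    by exists (rep m), (root m); rewrite root_Adeg rep_Adeg.
  apply: (fiber_ind Apos (linked_equiv _)).
    by move=> k s t; exact: linked_add.
  move=> u v IH [duv _].
  have conn s t : connected A s t -> Adeg A s = Adeg A u -> linked star_basis s t.
    by apply: (connected_sub Apos (linked_equiv _)) => // k x y; exact: linked_add.
  have to_root s : Adeg A s = Adeg A u -> linked star_basis s (root s).
    move=> ds; apply: rst_trans (conn _ _ (rep_connected s) ds) _.
    have [->|ne] := eqVneq (rep s) (root s); first exact: rst_refl.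
    apply: rst_step; exists 0%MM, (rep s), (root s).
    by split; rewrite ?add0m //; exists s.
  apply: rst_trans (to_root u erefl) _; rewrite duv.
  by apply: rst_sym; apply: to_root.
split=> // B sub genB; apply/seteqP; split=> // p [m [ne pE]].
apply: contrapT => nBp.
have out m' : B ('X_[rep m'] - 'X_[root m']) -> rep m' != root m' ->
    ~ connected A (rep m) (rep m') /\ ~ connected A (rep m) (root m').
  move=> Bm' ne'; split=> /[dup] /connected_Adeg d /rep_eq; rewrite !repK => e.
    by apply: nBp; rewrite pE e; move: d; rewrite !rep_Adeg => ->.
  by move: ne; rewrite e; move: d; rewrite rep_Adeg root_Adeg => ->; rewrite eqxx.
have inv s t : linked B s t -> connected A (rep m) s <-> connected A (rep m) t.
  elim=> {s t} [s t [w [a [b [Bab -> ->]]]]|//|s t _ -> //|s t r _ -> _ -> //].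
  have [m' [ne' E]] := sub _ Bab.
  have [nr nr'] : ~ connected A (rep m) (rep m') /\ ~ connected A (rep m) (root m').
    by apply: out => //; rewrite -E.
  have ab : a != b by rewrite -(binomial_neq0 K) E binomial_neq0.
  have inj := binomial_inj ab E.
  (* A multiple by a nonconstant monomial stays inside a component. *)
  have [->|/mnm_neq0P[k wk]] := eqVneq w 0%MM.
    by rewrite !add0m; case: inj => -[-> ->].
  have st : connected A (w + a)%MM (w + b)%MM.
    apply: rst_step; split; last first.
      by exists k; rewrite !mnmDE !addn_eq0 !negb_and wk.
    by rewrite !AdegD; case: inj => -[-> ->]; rewrite !rep_Adeg base_Adeg.
  split=> rs; first exact: rst_trans rs st.
  by apply: rst_trans rs _; apply: rst_sym.
have dm : Adeg A (rep m) = Adeg A (root m) by rewrite rep_Adeg root_Adeg.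
have [H _] := inv _ _ (generating_linked genB dm).
have /rep_eq := H (rst_refl _ _ _).
by rewrite !repK => e; rewrite e eqxx in ne.
Qed.

End Star.

Lemma separated_markov u v : separated A u v ->
  exists B, markov_basis A B /\ B ('X_[u] - 'X_[v]).
Proof.
move=> suv; have [duv nuv] := suv.
pose rep m := if `[<connected A u m>] then u else
  if `[<connected A v m>] then v else xget u [set m' | connected A m m'].
pose base d := if d == Adeg A u then v else xget u [set m | Adeg A m = d].
have repu : rep u = u by rewrite /rep asboolT //; exact: rst_refl.
have repv : rep v = v.
  by rewrite /rep asboolF // asboolT //; exact: rst_refl.
have baseu : base (Adeg A u) = v by rewrite /base eqxx.
exists (star_basis rep base); split; last first.
  by exists u; rewrite baseu repu repv; split=> //; exact: separated_neq suv.
apply: star_markov => [m|s t st|m].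
- rewrite /rep; case: asboolP => [/connected_sym //|_].
  case: asboolP => [/connected_sym //|_].
  apply: (@xgetPex _ u [set m' | connected A m m']).
  by exists m; exact: rst_refl.
- have E x : connected A x s <-> connected A x t.
    split=> xs; first exact: rst_trans xs st.
    by apply: rst_trans xs _; apply: rst_sym.
  rewrite /rep (asbool_equiv_eq (E u)) (asbool_equiv_eq (E v)).
  suff -> : [set m | connected A s m] = [set m | connected A t m] by [].
  apply/seteqP; split=> m /= sm; apply: rst_sym.
    by apply/E; apply: rst_sym.
  by apply/E; apply: rst_sym.
- rewrite /base; case: eqP => [->//|_].
  by apply: (@xgetPex _ u [set m' | Adeg A m' = Adeg A m]); exists m.
Qed.

(** If [u] and [v] were connected, their binomial would follow from the
    elements of smaller degree and could be removed from the basis. *)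
Lemma markov_separated B u v : markov_basis A B -> B ('X_[u] - 'X_[v]) ->
  separated A u v.
Proof.
move=> [genB minB] Buv.
have Bdeg a b : B ('X_[a] - 'X_[b]) -> Adeg A a = Adeg A b.
  move=> Bab; have [_ BI] := genB; apply/(toric_binomialP K).
  by rewrite /toric_binomial -BI; apply: ideal_gen_sub.
split; first exact: Bdeg; move=> cuv.
pose B' := B `\ ('X_[u] - 'X_[v]).
have steps s t : binomial_move B s t ->
    linked B' s t \/ ((Adeg A u <= Adeg A s)%N /\ (linked B' u v -> linked B' s t)).
  move=> [w [a [b [Bab -> ->]]]].
  have [->|ab] := eqVneq a b; first by left; exact: rst_refl.
  case: (pselect ('X_[K, a] - 'X_[b] = 'X_[u] - 'X_[v])) => [E|ne]; last first.
    by left; apply: rst_step; exists w, a, b.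
  right; rewrite AdegD; have := Bdeg _ _ Buv.
  case: (binomial_inj ab E) => -[-> ->] duv; split; rewrite ?duv ?leq_addl //.
    exact: linked_add.
  by move=> uv; apply/linked_add/rst_sym.
have gen := generating_linked genB.
have low s t : linked B s t -> (Adeg A s < Adeg A u)%N -> linked B' s t.
  have deg x y : linked B x y -> Adeg A x = Adeg A y.
    elim=> {x y} [_ _ [w [a [b [/Bdeg dab -> ->]]]]|//|x y _ -> //|x y z _ -> _ -> //].
    by rewrite !AdegD dab.
  elim=> {s t} [s t /steps [//|[le _] lt]|s _|s t st IH lt|s r t sr IH rt IH' lt].
  - by move: lt; rewrite ltnNge le.
  - exact: rst_refl.
  - by apply: rst_sym; apply: IH; rewrite (deg _ _ st).
  - by apply: rst_trans (IH lt) (IH' _); rewrite -(deg _ _ sr).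
have uv : linked B' u v.
  apply: (connected_sub Apos (linked_equiv _) _ _ cuv erefl).
    by move=> k x y; exact: linked_add.
  by move=> s t dst; apply: low; apply: gen.
have all s t : linked B s t -> linked B' s t.
  elim=> {s t} [s t /steps [//|[_]]|s|s t _|s r t _ sr _ rt].
  - exact.
  - exact: rst_refl.
  - exact: rst_sym.
  - exact: rst_trans sr rt.
have B'B : B' `<=` B by move=> p [].
have B'E : B' = B.
  apply: minB => //; apply: linked_generating => [p /B'B|s t dst].
    case: genB => Bbin _ /Bbin[s [t [/toric_binomialP dst ->]]].
    by exists s, t.
  by apply: all; apply: gen.
by move: Buv; rewrite -B'E => -[_]; apply.
Qed.

Lemma universal_markovP p : universal_markov_basis K A p <->
  exists u v, separated A u v /\ p = 'X_[u] - 'X_[v].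
Proof.
split=> [[B [mB Bp]]|[u [v [/separated_markov[B [mB Buv]] ->]]]]; last first.
  by exists B.
have [[Bbin _] _] := mB; have [u [v [_ pE]]] := Bbin _ Bp.
by exists u, v; split=> //; apply: (markov_separated mB); rewrite -pE.
Qed.

Lemma separated_betti u v : separated A u v -> betti_degree K A (Adeg A u).
Proof. by move=> /separated_markov[B [mB Buv]]; exists B, u, v. Qed.

(** * Primitive binomials *)

Lemma primitive_binomialP u v : primitive_binomial K A u v <->
  [/\ Adeg A u = Adeg A v, u != v & forall w z, Adeg A w = Adeg A z -> w != z ->
     (w <= u)%MM -> (z <= v)%MM -> w = u /\ z = v].
Proof.
split=> [[/nonzero_toric_binomialP[duv uv] prim]|[duv uv prim]]; last first.
  split; first exact/nonzero_toric_binomialP.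
  by move=> w z /nonzero_toric_binomialP[dwz wz] wu zv; case: (prim w z) => // -> ->.
split=> // w z dwz wz wu zv.
have E : 'X_[K, w] - 'X_[z] = 'X_[u] - 'X_[v].
  by apply: prim => //; apply/nonzero_toric_binomialP.
have [//|[wE zE]] := binomial_inj wz E; case/eqP: uv.
by apply: (lem_Adeg_eq Apos) => //; rewrite -zE.
Qed.

(** If a smaller binomial with sides [w] and [z] existed, [u - w + z] would share
    a variable with both [u] and [v] and connect them. *)
Lemma separated_primitive u v : separated A u v -> primitive_binomial K A u v.
Proof.
move=> suv; have [duv nuv] := suv; apply/primitive_binomialP; split=> //.
  exact: separated_neq suv.
move=> w z dwz wz wu zv.
have [wE|wu'] := eqVneq w u.
  by split=> //; apply: (lem_Adeg_eq Apos) => //; rewrite -dwz wE.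
exfalso; apply: nuv.
have /mnm_neq0P[k zk] : z != 0%MM.
  apply: contra_neq wz => z0; move: dwz; rewrite z0 => /eqP.
  by rewrite (eqP (_ : Adeg A 0%MM == 0%N)) ?(Adeg_eq0 Apos) ?eqxx // => /eqP.
have /mnm_neq0P[l ul] : (u - w != 0)%MM.
  by apply: contra_neq wu' => uw; rewrite -(submK wu) uw add0m.
pose m := (u - w + z)%MM.
have dum : Adeg A u = Adeg A m by rewrite AdegD -dwz -AdegD submK.
have um : connected A u m.
  apply: rst_step; split=> //; exists l; move: ul; rewrite mnmDE mnmBE; lia.
have mv : connected A m v.
  apply: rst_step; split; first by rewrite -dum.
  by exists k; have /mnm_lepP/(_ k) := zv; move: zk; rewrite mnmDE; lia.
exact: rst_trans um mv.
Qed.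

End Markov.

(** * Critical binomials *)

Section CriticalBinomials.
Variables (n : nat) (K : fieldType) (A : n.-tuple nat).
Hypothesis Apos : forall i, (0 < tnth A i)%N.
Hypothesis Auniq : uniq A.
Local Open Scope ring_scope.
Implicit Types (u v w r : 'X_{1..n}) (i j l : 'I_n).

Lemma critical_multipleP i (k : nat) : critical_multiple A i k <->
  (0 < k)%N /\ exists r, r i = 0%N /\ Adeg A r = (k * tnth A i)%N.
Proof.
rewrite /critical_multiple; split=> -[k0 H]; split=> //.
  case: H => f; rewrite big_map big_filter big_enum_cond /= => fE.
  exists [multinom if j == i then 0%N else f (tnth A j) | j < n].
  split; first by rewrite mnmE eqxx.
  rewrite fE /Adeg [RHS]big_mkcond; apply: eq_bigr => j _; rewrite mnmE.
  by case: eqP.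
case: H => r [ri dr]; have tinj : injective (tnth A) by exact/tuple_uniqP.
pose f x := if [pick j | tnth A j == x] is Some j then r j else 0%N.
have fE j : f (tnth A j) = r j.
  rewrite /f; case: pickP => [j' /eqP/tinj -> //|/(_ j)]; by rewrite eqxx.
exists f; rewrite big_map big_filter big_enum_cond /= -dr /Adeg [RHS]big_mkcond.
by apply: eq_bigr => j _; rewrite fE; case: eqP => [->|//]; rewrite ri.
Qed.

(** Distinct monomials of equal degree force at least two variables, and then
    any generator has a positive multiple in the monoid of the others. *)
Lemma critical_exponent_exists u v : u != v -> Adeg A u = Adeg A v ->
  exists c, forall i, critical_exponent A i (c i).
Proof.
move=> uv duv.
have [i0 ne0] : exists i, u i != v i.
  apply/existsP; apply: contraNT uv => /existsPn H; apply/eqP/mnmP => i.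
  by apply/eqP; rewrite -[_ == _]negbK.
have [j0 ji] : exists j, j != i0.
  apply: contrapT => nex; case/eqP: ne0; apply/eqP.
  move: duv; rewrite /Adeg (bigD1 i0) // [RHS](bigD1 i0) //= !big1 ?addn0.
  - by move/eqP; rewrite eqn_pmul2r // => /eqP.
  - by move=> j ji; case: nex; exists j.
  - by move=> j ji; case: nex; exists j.
have other i : exists j, j != i.
  by have [->|ne] := eqVneq i i0; [exists j0 | exists i0; rewrite eq_sym].
suff H i : exists k : nat, critical_exponent A i k by have [c cP] := choice H; exists c.
have [j ne] := other i.
have ex : exists k : nat, `[<critical_multiple A i k>].
  (* The product of the two generators is a common multiple. *)
  exists (tnth A j); apply/asboolP/critical_multipleP; split=> //.
  exists (U_(j) *+ tnth A i)%MM; rewrite pureE (negbTE ne); split=> //.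
  by rewrite Adeg_pure mulnC.
have [k /asboolP mk kmin] := ex_minnP ex.
by exists k; split=> // k' /asboolP; exact: kmin.
Qed.

Variable c : 'I_n -> nat.
Hypothesis c_crit : forall i, critical_exponent A i (c i).

Notation P i := (U_(i) *+ c i)%MM.
Notation C i := (c i * tnth A i)%N.

Lemma critical_gt0 i : (0 < c i)%N.
Proof. by case: (c_crit i) => -[]. Qed.

Lemma critical_relation i : exists r, r i = 0%N /\ Adeg A r = C i.
Proof. by case: (c_crit i) => /critical_multipleP[]. Qed.

Lemma critical_min i (k : nat) r :
  (0 < k)%N -> r i = 0%N -> Adeg A r = (k * tnth A i)%N -> (c i <= k)%N.
Proof.
move=> k0 ri dr; case: (c_crit i) => _; apply.
by apply/critical_multipleP; split=> //; exists r.
Qed.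

Lemma critical_binomialsP p : critical_binomials K A p <->
  exists i r, [/\ r i = 0%N, Adeg A r = C i &
    p = 'X_[P i] - 'X_[r] \/ p = 'X_[r] - 'X_[P i]].
Proof.
have cE i k : critical_exponent A i k -> k = c i.
  move=> [mk mink]; have [mc minc] := c_crit i.
  by apply/eqP; rewrite eqn_leq mink ?minc.
split=> [[[i [k [r [/cE -> ri dr pE]]]]|[i [k [r [/cE -> ri dr pE]]]]]|].
- by exists i, r; split=> //; left; rewrite pE mpolyXn.
- exists i, r; split=> //; right; rewrite mpolyXn in pE.
  by rewrite -opprB -pE opprK.
- move=> [i [r [ri dr [|] ->]]].
    by left; exists i, (c i), r; rewrite mpolyXn.
  by right; exists i, (c i), r; rewrite mpolyXn opprB.
Qed.

Lemma critical_sub_markov : critical_binomials K A `<=` universal_markov_basis K A.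
Proof.
move=> p /critical_binomialsP[i [r [ri dr pE]]]; apply/(universal_markovP Apos).
have sep := crit_separated Apos critical_gt0 critical_min ri dr.
case: pE => ->; first by exists (P i), r.
by exists r, (P i); split=> //; exact: separated_sym.
Qed.

Hypothesis hbetti : betti_divisible K A.

Lemma betti_dvd u v u' v' : separated A u v -> separated A u' v' ->
  (Adeg A u %| Adeg A u')%N \/ (Adeg A u' %| Adeg A u)%N.
Proof.
by move=> uv uv'; apply: hbetti; [exact: separated_betti uv | exact: separated_betti uv'].
Qed.

(** By [disjoint_pair] a primitive binomial is divisible, side by side, by a
    critical one. *)
Lemma graver_sub_critical : graver_basis K A `<=` critical_binomials K A.
Proof.
move=> p [u [v [/(primitive_binomialP _ Apos)[duv uv prim] ->]]].
have dis : disjoint_mnm u v.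
  move=> l; have [|ul] := eqVneq (u l) 0%N; first by left.
  have [|vl] := eqVneq (v l) 0%N; first by right.
  have Uu : (U_(l) <= u)%MM by rewrite lep1mP.
  have Uv : (U_(l) <= v)%MM by rewrite lep1mP.
  have [||||/mnmP/(_ l)] := prim (u - U_(l))%MM (v - U_(l))%MM.
  - by rewrite !AdegB // duv.
  - by apply: contra_neq uv => E; rewrite -(submK Uu) E submK.
  - exact: lem_subr.
  - exact: lem_subr.
  - by rewrite mnmBE mnm1E eqxx; lia.
have [j [w [dw]]] := disjoint_pair Apos critical_gt0 critical_relation critical_min
  betti_dvd duv dis uv.
case=> -[wle Pj xj]; apply/critical_binomialsP.
  have [|||//|wE PE] := prim w (P j); rewrite ?Adeg_pure //.
    apply: contraTneq wle => ->; rewrite pure_lem xj -ltnNge; exact: critical_gt0.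
  by exists j, u; split=> //; [rewrite -wE | right; rewrite PE].
have [|||//|PE wE] := prim (P j) w; rewrite ?Adeg_pure //.
  rewrite eq_sym; apply: contraTneq wle => ->.
  by rewrite pure_lem xj -ltnNge; exact: critical_gt0.
by exists j, v; split=> //; [rewrite -wE | left; rewrite PE].
Qed.

End CriticalBinomials.

(** * Circuits *)

Section Circuits.
Variables (n : nat) (K : fieldType) (A : n.-tuple nat).
Hypothesis Apos : forall i, (0 < tnth A i)%N.
Hypothesis Auniq : uniq A.
Local Open Scope ring_scope.
Implicit Types (u v w z r : 'X_{1..n}) (i j l : 'I_n).

Variable c : 'I_n -> nat.
Hypothesis c_crit : forall i, critical_exponent A i (c i).

Notation P i := (U_(i) *+ c i)%MM.
Notation C i := (c i * tnth A i)%N.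

Hypothesis C_dvd : forall i j, (C i <= C j)%N -> (C i %| C j)%N.

Lemma irreducible_binomial_sym u v :
  irreducible_binomial K A u v -> irreducible_binomial K A v u.
Proof.
case=> /toric_binomialP duv dis g1; split.
- by apply/toric_binomialP.
- by rewrite disjoint_sym.
- by rewrite -[RHS]g1; apply: eq_bigr => i _; rewrite addnC.
Qed.

(** Since [C i] divides [C j], the latter is a common multiple of the two
    generators; coprimality makes [t] a divisor of [c j], and minimality of
    [c j] gives the converse inequality. *)
Lemma coprime_pure_pair i j (s t : nat) : i != j -> (C i <= C j)%N -> (0 < t)%N ->
  coprime s t -> (s * tnth A i = t * tnth A j)%N -> t = c j.
Proof.
move=> ij Cij t0 cst E.
have /dvdnP[q qE] : (tnth A i %| C j)%N
  by apply: dvdn_trans (C_dvd Cij); exact: dvdn_mull.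
apply/eqP; rewrite eqn_leq; apply/andP; split; last first.
  apply: (critical_min Auniq c_crit (r := (U_(i) *+ s)%MM)) => //.
    by rewrite pureE (negbTE ij).
  by rewrite Adeg_pure.
apply: dvdn_leq; first exact: (critical_gt0 c_crit).
rewrite -(Gauss_dvdr _ (_ : coprime t s)); last by rewrite coprime_sym.
apply/dvdnP; exists q; apply/eqP.
rewrite -(eqn_pmul2r (Apos j)); apply/eqP.
by rewrite -mulnA qE mulnCA E mulnA.
Qed.

(** The least common multiple of two generators is the larger of their critical
    degrees, so a circuit is critical and both its sides are pure powers. *)
Lemma circuitsP p : circuits K A p <->
  exists i j (s : nat), [/\ i != j, (s * tnth A i)%N = C j &
    p = 'X_[U_(i) *+ s] - 'X_[P j] \/ p = 'X_[P j] - 'X_[U_(i) *+ s]].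
Proof.
split=> [[u [v [[/toric_binomialP duv dis g1] smin ->]]]|].
  have dis' l : u l != 0%N -> v l = 0%N.
    move=> ul; apply/eqP; apply: contraTT dis => vl; apply/pred0Pn; exists l.
    by rewrite /= !inE ul vl.
  have uv : u != v.
    apply: contra_eq_neq g1 => uv; rewrite big1 // => l _.
    by have [ul|/dis'] := eqVneq (u l) 0%N; rewrite -?uv ?ul // => ->.
  have /mnm_neq0P[i ui] : u != 0%MM.
    by apply: contra_neq uv => u0; apply/(lem_Adeg_eq Apos) => //; rewrite u0 lem0m.
  have /mnm_neq0P[j vj] : v != 0%MM.
    by apply: contra_neq uv => v0; apply/esym/(lem_Adeg_eq Apos) => //; rewrite v0 lem0m.
  have ij : i != j by apply: contraNneq vj => <-; rewrite dis'.
  (* Minimality is tested against x_i ^ (tnth A j) - x_j ^ (tnth A i). *)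
  have off l : l != i -> l != j -> (u l = 0 /\ v l = 0)%N.
    move=> li lj; have := smin (U_(i) *+ tnth A j)%MM (U_(j) *+ tnth A i)%MM.
    have ai : tnth A i != 0%N by rewrite -lt0n.
    have aj : tnth A j != 0%N by rewrite -lt0n.
    have nz : nonzero_toric_binomial K A (U_(i) *+ tnth A j)%MM (U_(j) *+ tnth A i)%MM.
      apply/nonzero_toric_binomialP; rewrite !Adeg_pure mulnC; split=> //.
      apply/eqP => /mnmP/(_ i); rewrite !pureE eqxx eq_sym (negbTE ij).
      by move/eqP; rewrite (negbTE aj).
    move=> /(_ nz); rewrite properE negb_and negbK => /orP[|].
      case/subsetPn => k kij /negP[]; move: kij; rewrite !inE !pureE.
      have [<-|_] := eqVneq i k; first by rewrite ui.
      by have [<-|_] := eqVneq j k; first by rewrite vj orbT.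
    move=> /fintype.subsetP/(_ l);
    rewrite !inE !pureE ![_ == l]eq_sym (negbTE li) (negbTE lj) /=.
    by case: (u l) (v l) => [|?] [|?] // /(_ isT).
  have uE : u = (U_(i) *+ u i)%MM.
    apply: pure_of_supp => l li; have [->|lj] := eqVneq l j; last by case: (off l).
    by apply/eqP; apply: contraNT vj => /dis' ->.
  have vE : v = (U_(j) *+ v j)%MM.
    apply: pure_of_supp => l lj; have [->|li] := eqVneq l i; last by case: (off l).
    exact: dis'.
  have E : (u i * tnth A i = v j * tnth A j)%N by rewrite -!Adeg_pure -uE -vE.
  have cop : coprime (u i) (v j).
    rewrite /coprime -dvdn1 -[X in (_ %| X)%N]g1.
    apply: (big_ind (fun x => gcdn (u i) (v j) %| x)%N) => [|x y dx dy|l _].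
    - exact: dvdn0.
    - by rewrite dvdn_gcd dx dy.
    have ul : u l = if i == l then u i else 0%N by rewrite {1}uE pureE.
    have vl : v l = if j == l then v j else 0%N by rewrite {1}vE pureE.
    rewrite ul vl; apply: dvdn_add; case: (_ == l); rewrite ?dvdn0 //.
      exact: dvdn_gcdl.
    exact: dvdn_gcdr.
  case/orP: (leq_total (C i) (C j)) => le.
    have vjE := coprime_pure_pair ij le (_ : 0 < v j)%N cop E.
    exists i, j, (u i); rewrite -vjE ?lt0n //; split=> //; left.
    by rewrite -uE -vE.
  rewrite eq_sym in ij; rewrite coprime_sym in cop.
  have uiE := coprime_pure_pair ij le (_ : 0 < u i)%N cop (esym E).
  exists j, i, (v j); rewrite -uiE ?lt0n //; split=> //; right.
  by rewrite -uE -vE.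
move=> [i [j [s [ij sE pE]]]].
set u := (U_(i) *+ s)%MM in pE *; set v := (P j) in pE *.
have s0 : s != 0%N.
  apply: contraTneq (C_gt0 Apos (critical_gt0 c_crit) j) => s0.
  by rewrite -sE s0.
have c0 : c j != 0%N by rewrite -lt0n; exact: critical_gt0.
have suE : supp u = [set i]%SET.
  by apply/setP => l; rewrite !inE pureE (eq_sym l); case: (i == l).
have svE : supp v = [set j]%SET.
  by apply/setP => l; rewrite !inE pureE (eq_sym l); case: (j == l).
have irr : irreducible_binomial K A u v.
  split.
  - by apply/toric_binomialP; rewrite !Adeg_pure.
  - by rewrite suE svE finset.disjoints_subset finset.sub1set !inE.
  set g := (\big[gcdn/0%N]_(l < n) _).
  have gdvd l : (g %| u l + v l)%N by rewrite /g (bigD1 l) //= dvdn_gcdl.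
  have := gdvd i; have := gdvd j; rewrite !pureE !eqxx (negbTE ij) eq_sym (negbTE ij).
  rewrite add0n addn0 => /dvdnP[c' cE] /dvdnP[s' s'E].
  have g0 : (0 < g)%N by move: c0; rewrite cE muln_eq0 negb_or lt0n => /andP[].
  have : (c j <= c')%N.
    apply: (critical_min Auniq c_crit (r := (U_(i) *+ s')%MM)).
    - by move: c0; rewrite cE muln_eq0 negb_or lt0n => /andP[].
    - by rewrite pureE (negbTE ij).
    - apply/eqP; rewrite Adeg_pure -(eqn_pmul2l g0) !mulnA ![(g * _)%N]mulnC.
      by rewrite -cE -s'E sE.
  by move: c0; rewrite cE; clear -g0; nia.
have smin w z : nonzero_toric_binomial K A w z ->
    ~~ (supp w :|: supp z \proper supp u :|: supp v)%SET.
  move=> /nonzero_toric_binomialP[dwz wz]; apply/negP => /properP[sub [x xuv xwz]].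
  have [k kP] : exists k, forall l, l != k -> (w l = 0 /\ z l = 0)%N.
    have H l : (w l != 0)%N || (z l != 0)%N -> (l == i) || (l == j).
      by move=> wzl; have /fintype.subsetP/(_ l) := sub; rewrite suE svE !inE; apply.
    exists (if x == i then j else i) => l lk.
    have : ~~ ((w l != 0)%N || (z l != 0)%N).
      apply/negP => wzl; have xl : x != l by apply: contraNneq xwz => ->; rewrite !inE.
      move: (H _ wzl) lk xl xuv; rewrite suE svE !inE.
      by case: (eqVneq x i) => [->|_] /orP[/eqP ->|/eqP ->];
        rewrite ?eqxx // => _ /negPf ->.
    by rewrite negb_or !negbK => /andP[/eqP -> /eqP ->].
  case/eqP: wz; have wE := @pure_of_supp _ k w (fun l lk => proj1 (kP l lk)).
  have zE := @pure_of_supp _ k z (fun l lk => proj2 (kP l lk)).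
  move: dwz; rewrite wE zE !Adeg_pure => /eqP; rewrite eqn_pmul2r // => /eqP E.
  by rewrite E.
case: pE => ->; first by exists u, v.
exists v, u; split=> //; first exact: irreducible_binomial_sym.
by move=> w z; rewrite [(supp v :|: _)%SET]finset.setUC; exact: smin.
Qed.

Lemma circuits_sub_critical : circuits K A `<=` critical_binomials K A.
Proof.
move=> p /circuitsP[i [j [s [ij sE pE]]]]; apply/(critical_binomialsP c_crit).
exists j, (U_(i) *+ s)%MM; rewrite pureE (negbTE ij) Adeg_pure; split=> //.
by case: pE; [right | left].
Qed.

End Circuits.

(** * Standard monomials *)

Section StandardMonomials.
Variables (n : nat) (K : fieldType) (A : n.-tuple nat).
Hypothesis Apos : forall i, (0 < tnth A i)%N.
Local Open Scope ring_scope.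
Implicit Types (p q g : {mpoly K[n]}) (t u v w m : 'X_{1..n}) (i j l : 'I_n).

Variable le : rel 'X_{1..n}.
Hypothesis le_order : monomial_order le.

Lemma order_refl : reflexive le.
Proof. by case: le_order => -[]. Qed.

Lemma order_anti u v : le u v -> le v u -> u = v.
Proof. by case: le_order => -[_ anti] _ _ _ _ uv vu; apply: anti; rewrite uv. Qed.

Lemma order_lem u v : (u <= v)%MM -> le u v.
Proof.
case: le_order => _ _ _ le0 leD uv.
by rewrite -(submK uv) -{1}(add0m u); apply: leD.
Qed.

(** By [leading_not_standard] and [leading_nonstandard], the standard monomials
    are those that lead no element of the toric ideal. *)
Definition standard t := forall t', Adeg A t' = Adeg A t -> le t t'.

Definition minimal_nonstandard u :=
  ~ standard u /\ forall w, (w <= u)%MM -> w != u -> standard w.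

Lemma standard_unique t t' :
  standard t -> standard t' -> Adeg A t = Adeg A t' -> t = t'.
Proof. by move=> st st' d; apply: order_anti; [apply: st | apply: st']. Qed.

Lemma standard_lem w t : (w <= t)%MM -> standard t -> standard w.
Proof.
case: le_order => _ _ tot _ leD wt st w' dw'.
case/orP: (tot w w') => // w'w.
have le1 : le (w' + (t - w))%MM t.
  by rewrite -{2}(submK wt) addmC [(t - w + w)%MM]addmC addmC; apply: leD.
have le2 : le t (w' + (t - w))%MM.
  by apply: st; rewrite AdegD dw' -AdegD addmC submK.
have /esym E := order_anti le1 le2.
have -> : w' = w by apply/(@addIm _ (t - w)%MM); rewrite -E [RHS]addmC submK.
exact: order_refl.
Qed.

(** A fiber is finite because the degree bounds the ordinary total degree. *)
Lemma normal_form_exists : exists nf : 'X_{1..n} -> 'X_{1..n},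
  forall u, Adeg A (nf u) = Adeg A u /\ standard (nf u).
Proof.
suff H u : exists t, Adeg A t = Adeg A u /\ standard t.
  by have [nf nfP] := choice H; exists nf.
case: le_order => _ tr tot _ _.
have min_seq (s : seq 'X_{1..n}) x :
    exists2 y, y \in x :: s & forall z, z \in x :: s -> le y z.
  elim: s x => [|y s IH] x.
    by exists x; rewrite ?inE // => z; rewrite inE => /eqP ->; exact: order_refl.
  have [z zs zmin] := IH y; case/orP: (tot x z) => xz.
    exists x; first exact: mem_head.
    move=> t; rewrite in_cons => /orP[/eqP ->|/zmin]; first exact: order_refl.
    exact: tr.
  exists z; first by rewrite in_cons zs orbT.
  by move=> t; rewrite in_cons => /orP[/eqP ->|/zmin].
have mdeg_lt t : Adeg A t = Adeg A u -> (mdeg t < (Adeg A u).+1)%N.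
  by move=> <-; rewrite ltnS mdegE; apply: leq_sum => i _; exact: leq_pmulr.
pose s := [seq t <- [seq val b | b <- enum {: 'X_{1..n < (Adeg A u).+1}}] |
           Adeg A t == Adeg A u].
have [t ts tmin] := min_seq s u; exists t.
have dt : Adeg A t = Adeg A u.
  by move: ts; rewrite in_cons mem_filter => /orP[/eqP ->|/andP[/eqP]].
split=> // t'; rewrite dt => dt'; apply: tmin.
rewrite in_cons mem_filter dt' eqxx; apply/orP; right; apply/mapP.
by exists (BMultinom (mdeg_lt t' dt')) => //; rewrite mem_enum.
Qed.

Lemma leading_unique g u v : leading_monomial le g u -> leading_monomial le g v -> u = v.
Proof. by move=> [ug umax] [vg vmax]; apply: order_anti; [apply: vmax | apply: umax]. Qed.

Lemma leading_not_standard p m :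
  toric_ideal K A p -> leading_monomial le p m -> ~ standard m.
Proof.
move=> Ip [mp mmax] sm; have [m' [m'p ne dm]] := toric_fiber_companion Ip mp.
by case/eqP: ne; apply: order_anti; [exact: mmax | exact: sm].
Qed.

Lemma msupp_binomial u v t : u != v ->
  (t \in msupp ('X_[K, u] - 'X_[v])) = (t == u) || (t == v).
Proof.
move=> uv; rewrite mcoeff_msupp mcoeffB !mcoeffX ![_ == t]eq_sym.
have [->|tu] := eqVneq t u; first by rewrite (negbTE uv) subr0 oner_neq0.
by rewrite sub0r oppr_eq0; case: (t == v); rewrite ?oner_neq0 ?eqxx.
Qed.

Lemma nonstandard_binomial u v : ~ standard u -> standard v -> Adeg A u = Adeg A v ->
  u != v /\ leading_monomial le ('X_[K, u] - 'X_[v]) u.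
Proof.
move=> nu sv duv; have uv : u != v by apply/eqP => uv; rewrite uv in nu.
split=> //; split; first by rewrite msupp_binomial // eqxx.
move=> t; rewrite msupp_binomial // => /orP[/eqP ->|/eqP ->]; first exact: order_refl.
exact: sv.
Qed.

Lemma leading_nonstandard m : ~ standard m ->
  leading_monomials le (toric_ideal K A) 'X_[m].
Proof.
move=> nm; have [nf /(_ m)[dnf snf]] := normal_form_exists.
have [_ lead] := nonstandard_binomial nm snf (esym dnf).
by exists ('X_[m] - 'X_[nf m]), m; split=> //; apply/toric_binomialP.
Qed.

(** A fiber contains a single standard monomial, which would have no companion
    in the support of [p]. *)
Lemma standard_ideal0 p : toric_ideal K A p ->
  (forall m, m \in msupp p -> standard m) -> p = 0.
Proof.
move=> Ip sp; apply/eqP; rewrite -msupp_eq0; case E: (msupp p) => [//|m s].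
have mp : m \in msupp p by rewrite E mem_head.
have [m' [m'p ne dm]] := toric_fiber_companion Ip mp.
by case/eqP: ne; apply: standard_unique dm; exact: sp.
Qed.

(** * Reduced Groebner bases *)

Lemma mem_leading_ideal (H : set {mpoly K[n]}) m :
  ideal_gen (leading_monomials le H) 'X_[m] ->
  exists g t, [/\ H g, leading_monomial le g t & (t <= m)%MM].
Proof.
move=> [s [Hs sE]]; apply: contrapT => nex.
have /eqP : ('X_[K, m])@_m = 0.
  rewrite sE raddf_sum big_seq big1 // => -[f q] /Hs /= [g [t [Hg lead ->]]].
  apply: memN_msupp_eq0; rewrite (perm_mem (msuppMX _ _)); apply/mapP => -[m' _ mE].
  by apply: nex; exists g, t; split=> //; rewrite mE lem_addr.
by rewrite mcoeffX eqxx oner_eq0.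
Qed.

(** Reducedness makes every nonleading monomial of [g] and every proper divisor
    of its leading monomial standard; subtracting the binomial of the leading
    monomial and its normal form leaves a polynomial with standard monomials
    only, which is zero by [standard_ideal0]. *)
Lemma reduced_groebner_element G g :
  reduced_groebner_basis le (toric_ideal K A) G -> g \in G ->
  exists u v, [/\ g = 'X_[u] - 'X_[v], minimal_nonstandard u, standard v &
    Adeg A u = Adeg A v].
Proof.
move=> [[GI lmE] monic red] gG; have [u [lead gu]] := monic g gG.
have cover t : ~ standard t -> exists g' t',
    [/\ g' \in G, leading_monomial le g' t' & (t' <= t)%MM].
  move=> /leading_nonstandard /ideal_gen_sub; rewrite -lmE.
  by move=> /mem_leading_ideal[g' [t' [Gg' lead' le']]]; exists g', t'.
have tail t : t \in msupp g -> t != u -> standard t.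
  move=> tg tu; apply: contrapT => /cover[g' [t' [g'G lead' le']]].
  have [E|ne] := eqVneq g' g; last first.
    by have := red g g' t' t gG g'G ne lead' tg; rewrite le'.
  rewrite E in lead'; case/eqP: tu; apply: order_anti; first by case: lead => _; apply.
  by rewrite (leading_unique lead lead'); exact: order_lem.
have nu : ~ standard u := leading_not_standard (GI g gG) lead.
have minu : minimal_nonstandard u.
  split=> // w wu ne; apply: contrapT => /cover[g' [t' [g'G lead' le']]].
  have [E|ne'] := eqVneq g' g.
    rewrite E in lead'; case/eqP: ne; apply: lem_anti => //.
    by rewrite (leading_unique lead lead').
  have := red g g' t' u gG g'G ne' lead' (proj1 lead).
  by rewrite (lepm_trans le' wu).
have [nf /(_ u)[dnf snf]] := normal_form_exists.
have [unf _] := nonstandard_binomial nu snf (esym dnf).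
exists u, (nf u); split=> //; apply/eqP; rewrite -subr_eq0; apply/eqP.
apply: standard_ideal0 => [|m].
  apply: ideal_genD; first exact: GI.
  by apply: ideal_genN; apply/toric_binomialP.
have [->|mu] := eqVneq m u.
  rewrite mcoeff_msupp !mcoeffB gu !mcoeffX.
  by rewrite eqxx (eq_sym (nf u)) (negbTE unf) subr0 subrr eqxx.
move=> /msuppB_le; rewrite mem_cat msupp_binomial // (negbTE mu) /=.
by case/orP => [/tail|/eqP ->]; [apply |].
Qed.

Lemma minimal_nonstandard_below m : ~ standard m ->
  exists2 u, (u <= m)%MM & minimal_nonstandard u.
Proof.
move: {2}(mdeg m) (leqnn (mdeg m)) => d; elim: d m => [|d IH] m md nm.
  have m0 : m = 0%MM by apply/eqP; rewrite -mdeg_eq0 -leqn0.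
  case: nm => t'; rewrite m0 => _; case: le_order => _ _ _ le0 _; exact: le0.
case: (pselect (minimal_nonstandard m)) => [mm|nmm].
  by exists m; rewrite ?lepm_refl.
have [w [wm ne nw]] : exists w, [/\ (w <= m)%MM, w != m & ~ standard w].
  apply: contrapT => nex; apply: nmm; split=> // w wm ne; apply: contrapT => nw.
  by apply: nex; exists w.
have lt : (mdeg w < mdeg m)%N.
  rewrite -(submK wm) mdegD -[X in (X < _)%N]add0n ltn_add2r lt0n mdeg_eq0.
  by apply: contra_neq ne => E; rewrite -(submK wm) E add0m.
have [|//|u uw mu] := IH w; first by rewrite -ltnS (leq_trans lt).
by exists u => //; exact: lepm_trans uw wm.
Qed.

(** The finite list [s] stands for the finiteness of the set of minimal
    generators of the initial ideal. *)
Lemma reduced_groebner_exists (s : seq 'X_{1..n}) :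
  (forall u, minimal_nonstandard u -> u \in s) ->
  exists G, reduced_groebner_basis le (toric_ideal K A) G /\
    forall u v, minimal_nonstandard u -> standard v -> Adeg A u = Adeg A v ->
      'X_[u] - 'X_[v] \in G.
Proof.
move=> ms; have [nf nfP] := normal_form_exists.
pose g u := 'X_[K, u] - 'X_[nf u].
pose G := [seq g u | u <- s & `[<minimal_nonstandard u>]].
have GP p : p \in G -> exists u, minimal_nonstandard u /\ p = g u.
  by move=> /mapP[u]; rewrite mem_filter => /andP[/asboolP mu _] ->; exists u.
have PG u : minimal_nonstandard u -> g u \in G.
  by move=> mu; apply: map_f; rewrite mem_filter ms // andbT; apply/asboolP.
have gI u : toric_ideal K A (g u) by apply/toric_binomialP; case: (nfP u).
have glead u : minimal_nonstandard u -> u != nf u /\ leading_monomial le (g u) u.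
  by case=> nu _; apply: nonstandard_binomial => //; case: (nfP u).
exists G; split; last first.
  move=> u v mu sv duv; suff <- : nf u = v by exact: PG.
  by have [d snf] := nfP u; apply: standard_unique => //; rewrite d.
split.
- split; first by move=> p /GP[u [_ ->]].
  apply/seteqP; split; apply: ideal_gen_min => _ [p [m [Hp lead ->]]].
    apply: ideal_gen_sub; exists p, m; split=> //.
    by have [u [_ ->]] := GP p Hp.
  have [u um mu] := minimal_nonstandard_below (leading_not_standard Hp lead).
  rewrite -(submK um) mpolyXD; apply: ideal_genM; apply: ideal_gen_sub.
  by exists (g u), u; split; [exact: PG | case: (glead u mu) |].
- move=> p /GP[u [mu ->]]; have [ne lead] := glead u mu; exists u; split=> //.
  by rewrite mcoeffB !mcoeffX eqxx (eq_sym (nf u)) (negbTE ne) subr0.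
- move=> p p' m t /GP[u [mu ->]] /GP[u' [mu' ->]] ne lead' tg; apply/negP => mt.
  have [uu' lead] := glead u' mu'; rewrite (leading_unique lead' lead) in mt.
  have [unf _] := glead u mu; move: tg; rewrite msupp_binomial //.
  have [nu' _] := mu'; case/orP => /eqP E; rewrite E in mt; last first.
    by apply: nu'; apply: standard_lem mt _; case: (nfP u).
  have [E'|ne'] := eqVneq u' u; first by rewrite E' eqxx in ne.
  by case: mu => _ /(_ u' mt ne').
Qed.

End StandardMonomials.

(** * The universal Groebner basis *)

Section UniversalGroebner.
Variables (n : nat) (K : fieldType) (A : n.-tuple nat).
Hypothesis Apos : forall i, (0 < tnth A i)%N.
Hypothesis Auniq : uniq A.
Local Open Scope ring_scope.
Implicit Types (t u v w : 'X_{1..n}) (i j l : 'I_n).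

Variable c : 'I_n -> nat.
Hypothesis c_crit : forall i, critical_exponent A i (c i).
Hypothesis hbetti : betti_divisible K A.

Notation P i := (U_(i) *+ c i)%MM.
Notation C i := (c i * tnth A i)%N.

Let c_gt0 := critical_gt0 c_crit.
Let c_min := critical_min Auniq c_crit.
Let c_rel := critical_relation Auniq c_crit.
Let c_betti := betti_dvd Apos hbetti.

Lemma critical_dvd i j : (C i <= C j)%N -> (C i %| C j)%N.
Proof. exact: (C_dvd_of_le Apos c_gt0 c_rel c_min c_betti). Qed.

(** All proper divisors of [u], and all divisors of [v], are standard, so
    distinct ones have distinct degrees. This makes the sides disjoint, forces
    the pair given by [disjoint_pair] to be [u] and [v], and makes the side other
    than the critical power pure by [crit_fiber_pure]. *)
Lemma minimal_nonstandard_pure le u v : monomial_order le ->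
  minimal_nonstandard A le u -> standard A le v -> Adeg A u = Adeg A v ->
  exists i j (s : nat), [/\ i != j, (s * tnth A i)%N = C j &
    (u = (U_(i) *+ s)%MM /\ v = P j) \/ (u = P j /\ v = (U_(i) *+ s)%MM)].
Proof.
move=> leo [nu pu] sv duv.
have uv : u != v by apply/eqP => uv; rewrite uv in nu.
have dis : disjoint_mnm u v.
  move=> l; have [|ul] := eqVneq (u l) 0%N; first by left.
  have [|vl] := eqVneq (v l) 0%N; first by right.
  have Uu : (U_(l) <= u)%MM by rewrite lep1mP.
  have Uv : (U_(l) <= v)%MM by rewrite lep1mP.
  case/eqP: uv; rewrite -(submK Uu) -(submK Uv); congr (_ + _)%MM.
  apply: (standard_unique (A := A) leo); last by rewrite !AdegB // duv.
    apply: pu; first exact: lem_subr.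
    by apply/eqP => /mnmP/(_ l); rewrite mnmBE mnm1E eqxx; lia.
  exact: (standard_lem leo) (lem_subr _ _) sv.
have pure_neq i j (k : nat) r : r = (U_(i) *+ k)%MM -> r j = 0%N -> Adeg A r = C j ->
    i != j /\ (k * tnth A i)%N = C j.
  move=> rE rj; rewrite {1}rE Adeg_pure => kE; split=> //.
  apply: contra_eq_neq rj => <-; rewrite rE pureE eqxx.
  by apply: contraTneq (C_gt0 Apos c_gt0 j) => k0; rewrite -kE k0.
have [j [w [dw]]] := disjoint_pair Apos c_gt0 c_rel c_min c_betti duv dis uv.
case=> -[wle Pj xj].
  have sP := standard_lem leo Pj sv.
  have wu : w = u.
    apply: contrapT => /eqP ne; have wP : w = P j.
      by apply: (standard_unique (A := A) leo) => //; [exact: pu | rewrite dw Adeg_pure].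
    have /mnm_lepP/(_ j) := wle; rewrite wP pureE eqxx xj leqn0 => /eqP c0.
    by have := c_gt0 j; rewrite c0.
  rewrite wu in dw.
  have vP : P j = v by apply: (lem_Adeg_eq Apos) => //; rewrite Adeg_pure -dw.
  have [|i [k uE]] := crit_fiber_pure Apos c_gt0 c_rel c_min c_betti xj dw.
    move=> x y xu yu xne yne; apply: (standard_unique (A := A) leo); exact: pu.
  by have [ij kE] := pure_neq i j k u uE xj dw; exists i, j, k; split=> //; left.
have sw := standard_lem leo wle sv.
have Pu : P j = u.
  apply: contrapT => /eqP ne; have wP : P j = w.
    by apply: (standard_unique (A := A) leo) => //; [exact: pu | rewrite dw Adeg_pure].
  have /mnm_lepP/(_ j) := wle; rewrite -wP pureE eqxx xj leqn0 => /eqP c0.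
  by have := c_gt0 j; rewrite c0.
have dv : Adeg A v = C j by rewrite -duv -Pu Adeg_pure.
have [|i [k vE]] := crit_fiber_pure Apos c_gt0 c_rel c_min c_betti xj dv.
  move=> x y xv yv _ _; apply: (standard_unique (A := A) leo);
    exact: (standard_lem leo) sv.
by have [ij kE] := pure_neq i j k v vE xj dv; exists i, j, k; split=> //; right.
Qed.

Lemma universal_groebner_sub_circuits :
  universal_groebner_basis K A `<=` circuits K A.
Proof.
have H le G g : monomial_order le -> reduced_groebner_basis le (toric_ideal K A) G ->
    g \in G -> exists i j (s : nat), [/\ i != j, (s * tnth A i)%N = C j &
    g = 'X_[U_(i) *+ s] - 'X_[P j] \/ g = 'X_[P j] - 'X_[U_(i) *+ s]].
  move=> leo red gG.
  have [u [v [-> mu sv duv]]] := reduced_groebner_element Apos leo red gG.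
  have [i [j [s [ij sE E]]]] := minimal_nonstandard_pure leo mu sv duv.
  by exists i, j, s; split=> //; case: E => -[-> ->]; [left | right].
move=> p [[le [G [leo red pG]]]|[le [G [leo red pG]]]];
  apply/(circuitsP Apos Auniq c_crit critical_dvd).
  exact: H leo red pG.
have [i [j [s [ij sE E]]]] := H _ _ _ leo red pG; exists i, j, s; split=> //.
by case: E => /(congr1 (@GRing.opp _)); rewrite opprK opprB; [right | left].
Qed.

Section LastVariable.
Variable i : 'I_n.

Definition other_weight u := (\sum_(l < n | l != i) u l)%N.

(** For this order every power of [x_i] is the least monomial of its fiber. *)
Definition last_le : rel 'X_{1..n} := fun u v =>
  (other_weight u < other_weight v)%N ||
  (other_weight u == other_weight v) && (u <= v)%O.

Lemma other_weightD u v : other_weight (u + v)%MM = (other_weight u + other_weight v)%N.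
Proof. by rewrite /other_weight -big_split; apply: eq_bigr => l _; rewrite mnmDE. Qed.

Lemma other_weight_eq0 u : (other_weight u == 0%N) -> u = (U_(i) *+ u i)%MM.
Proof.
rewrite sum_nat_eq0 => /forallP u0; apply: pure_of_supp => l li.
by have := u0 l; rewrite li => /eqP.
Qed.

Lemma other_weight_pure (s : nat) : other_weight (U_(i) *+ s)%MM = 0%N.
Proof. by apply: big1 => l li; rewrite pureE eq_sym (negbTE li). Qed.

Lemma last_le_order : monomial_order last_le.
Proof.
split; first split.
- by move=> u; rewrite /last_le eqxx Order.POrderTheory.lexx orbT.
- move=> u v /andP[]; rewrite /last_le => /orP[uv|/andP[/eqP E uv]].
    by case/orP => [vu|/andP[/eqP E _]]; lia.
  rewrite E ltnn eqxx /= => vu.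
  by apply/Order.POrderTheory.le_anti; rewrite uv.
- move=> v u w; rewrite /last_le => /orP[uv|/andP[/eqP -> uv]].
    by case/orP => [vw|/andP[/eqP <- _]]; rewrite ?uv // (ltn_trans uv vw).
  by case/orP => [->//|/andP[-> vw]]; rewrite (Order.POrderTheory.le_trans uv vw) orbT.
- move=> u v; rewrite /last_le; case: ltngtP => //= _.
  exact: Order.TotalTheory.le_total.
- move=> u; rewrite /last_le; have -> : other_weight 0%MM = 0%N.
    by rewrite /other_weight big1 // => l _; rewrite mnm0E.
  by case: (other_weight u) => [|?] //; rewrite ltnn eqxx le0m.
- move=> u v w; rewrite /last_le !other_weightD ltn_add2r eqn_add2r.
  by rewrite lemc_add2l.
Qed.

Lemma last_le_standard (s : nat) : standard A last_le (U_(i) *+ s)%MM.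
Proof.
move=> t dt; rewrite /last_le other_weight_pure.
have [t0|//] := posnP (other_weight t).
have tE := other_weight_eq0 (introT eqP t0).
move: dt; rewrite tE !Adeg_pure => /eqP; rewrite eqn_pmul2r // => /eqP ->.
by rewrite other_weight_pure eqxx Order.POrderTheory.lexx.
Qed.

End LastVariable.

(** By minimality of [c j], such a [w] is alone in its fiber, hence standard for
    every monomial order. *)
Lemma below_critical_unique j w t : (w <= P j)%MM -> w != P j ->
  Adeg A t = Adeg A w -> t = w.
Proof.
move=> wP ne dt.
have wE : w = (U_(j) *+ w j)%MM.
  apply: pure_of_supp => l lj; have /mnm_lepP/(_ l) := wP.
  by rewrite pureE eq_sym (negbTE lj) leqn0 => /eqP.
have wc : (w j < c j)%N.
  have /mnm_lepP/(_ j) := wP; rewrite pureE eqxx leq_eqVlt => /orP[/eqP E|//].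
  by rewrite wE E eqxx in ne.
have [le|lt] := leqP (w j) (t j).
  by apply/esym/(lem_Adeg_eq Apos) => //; rewrite wE pure_lem.
have tjt : (U_(j) *+ t j <= t)%MM by rewrite pure_lem.
have dw : Adeg A w = (w j * tnth A j)%N by rewrite {1}wE Adeg_pure.
have := @c_min j (w j - t j)%N (t - U_(j) *+ t j)%MM.
rewrite AdegB // Adeg_pure dt dw mnmBE pureE eqxx subnn -mulnBl.
by rewrite subn_gt0 lt => /(_ isT erefl erefl); lia.
Qed.

(** Take an order in which [x_i] comes last: the power of [x_i] is a normal form
    and the critical power of [x_j] a minimal nonstandard monomial. *)
Lemma circuits_sub_universal_groebner :
  circuits K A `<=` universal_groebner_basis K A.
Proof.
move=> p /(circuitsP Apos Auniq c_crit critical_dvd)[i [j [s [ij sE pE]]]].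
pose le := last_le i; have leo := last_le_order i.
(* For j = i the entry of this list is the critical power of x_j itself. *)
pose cand := [seq (U_(x.1) *+ (C x.2 %/ tnth A x.1))%MM | x <- enum {: 'I_n * 'I_n}].
have [nf nfP] := normal_form_exists Apos leo.
have candP u : minimal_nonstandard A le u -> u \in cand.
  move=> mu; have [dnf snf] := nfP u.
  have [i' [j' [s' [_ s'E E]]]] := minimal_nonstandard_pure leo mu snf (esym dnf).
  apply/mapP; case: E => -[uE _].
    by exists (i', j'); rewrite ?mem_enum //= -s'E mulnK.
  by exists (j', j'); rewrite ?mem_enum //= mulnK.
have [G [red inG]] := reduced_groebner_exists K Apos leo candP.
have gG : 'X_[P j] - 'X_[U_(i) *+ s] \in G.
  apply: inG; [| exact: last_le_standard | by rewrite !Adeg_pure].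
  split.
    move=> sP; have E : P j = (U_(i) *+ s)%MM.
      apply: (standard_unique (A := A) leo) => //; first exact: last_le_standard.
      by rewrite !Adeg_pure.
    have := c_gt0 j; move/mnmP/(_ j): E; rewrite !pureE eqxx (negbTE ij) => ->.
    by rewrite ltnn.
  move=> w wP ne t dt; rewrite (below_critical_unique wP ne dt); exact: order_refl.
by case: pE => ->; [right; rewrite opprB | left]; exists le, G.
Qed.

End UniversalGroebner.

Theorem theorem3p22 (K : fieldType) (n : nat) (A : n.-tuple nat)
    (S : set nat)
    (hS : numerical_semigroup S)
    (hA : minimally_generated S A)
    (hbetti : betti_divisible K A) :
  circuits K A = universal_groebner_basis K A /\
  universal_groebner_basis K A `<=` critical_binomials K A /\
  critical_binomials K A = universal_markov_basis K A /\
  universal_markov_basis K A = graver_basis K A.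
Proof.
have [Auniq Apos' _ _] := hA.
have Apos i : (0 < tnth A i)%N by apply: Apos'; exact: mem_tnth.
have crit u v : u != v -> Adeg A u = Adeg A v ->
    exists c, forall i, critical_exponent A i (c i).
  exact: critical_exponent_exists.
have CU : circuits K A `<=` universal_groebner_basis K A.
  move=> p Cp; have [u [v [[/toric_binomialP duv dis g1] _ _]]] := Cp.
  have [|c cP] := crit u v _ duv; last first.
    exact: (circuits_sub_universal_groebner Apos Auniq cP hbetti).
  apply: contra_eq_neq g1 => uv; rewrite big1 // => l _.
  by apply/eqP; rewrite addn_eq0 uv andbb; apply: contraTT dis => vl;
    apply/pred0Pn; exists l; rewrite /= !inE uv vl.
have UCCr p : universal_groebner_basis K A p ->
    circuits K A p /\ critical_binomials K A p.
  move=> Up; have [u [v [uv duv]]] : exists u v, u != v /\ Adeg A u = Adeg A v.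
    by case: Up => -[le [G [leo red pG]]];
      have [u [v [_ [nu _] sv duv]]] := reduced_groebner_element Apos leo red pG;
      exists u, v; split=> //; apply/eqP => uv; rewrite uv in nu.
  have [c cP] := crit u v uv duv.
  have Cp := universal_groebner_sub_circuits Apos Auniq cP hbetti Up.
  split=> //.
  exact: (circuits_sub_critical Apos Auniq cP (critical_dvd Apos Auniq cP hbetti)).
have CrM : critical_binomials K A `<=` universal_markov_basis K A.
  move=> p Crp; have [i [k [r [[[k0 _] _] ri dr]]]] : exists i k (r : 'X_{1..n}),
      [/\ critical_exponent A i k, r i = 0%N & (k * tnth A i)%N = Adeg A r].
    by case: Crp => -[i [k [r [ki ri dr _]]]]; exists i, k, r.
  have [||c cP] := crit (U_(i) *+ k)%MM r; last first.
  - exact: (critical_sub_markov Apos Auniq cP).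
  - by rewrite Adeg_pure.
  - by apply/eqP => /mnmP/(_ i); rewrite pureE eqxx ri; lia.
have MG : universal_markov_basis K A `<=` graver_basis K A.
  move=> p /(universal_markovP Apos)[u [v [suv ->]]].
  by exists u, v; split=> //; exact: separated_primitive.
have GCr : graver_basis K A `<=` critical_binomials K A.
  move=> p Gp; have [u [v [/(primitive_binomialP _ Apos)[duv uv _] _]]] := Gp.
  have [c cP] := crit u v uv duv.
  exact: (graver_sub_critical Apos Auniq cP hbetti).
split; [|split; [|split]].
- by apply/seteqP; split=> // p /UCCr[].
- by move=> p /UCCr[].
- by apply/seteqP; split=> // p /MG/GCr.
- by apply/seteqP; split=> // p /GCr/CrM.
Qed.
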